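(* Let $U\subseteq\mathbb{R}^n$ be open and let $L:U\times\mathbb{R}^n\to\mathbb{R}$, $(q,\dot q)\mapsto L(q,\dot q)$, be a smooth Lagrangian whose Hessian $\frac{\partial^2 L}{\partial\dot q\partial\dot q}(q,\dot q)$ is invertible everywhere. Then for every integer $N\ge1$ there exist smooth functions $L_1,\dots,L_N:U\times\mathbb{R}^n\to\mathbb{R}$ of $(q,\dot q)$ (independent of $h$) such that the surrogate Lagrangian of order $2N$, $$\hat L^{(2N)}=L+\sum_{i=1}^{N}h^{2i}L_i,$$ has modified Lagrangian $\hat L^{(2N)}_{\mathrm m}$ for the midpoint variational integrator (see context) satisfying, as formal power series in $h$, $$\hat L^{(2N)}_{\mathrm m}(q,\dot q)=L(q,\dot q)+O(h^{2N+2}).$$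
   Context: Conventions: $\frac{\partial^2 \Lambda}{\partial q\partial\dot q}$ is the matrix with $(i,j)$ entry $\frac{\partial^2 \Lambda}{\partial\dot q_i\partial q_j}$. For formal power series in $h$ whose coefficients are smooth functions on $U\times\mathbb{R}^n$, $A=B+O(h^k)$ means that the coefficients of $h^0,\dots,h^{k-1}$ in $A$ and $B$ coincide. Midpoint variational integrator: for a Lagrangian $\Lambda$ and time step $h$ the discrete Lagrangian is $\Lambda_{\mathrm d}(q_k,q_{k+1})=h\,\Lambda\big(\frac{q_k+q_{k+1}}{2},\frac{q_{k+1}-q_k}{h}\big)$, and the integrator is given by the discrete Euler--Lagrange equations $D_1\Lambda_{\mathrm d}(q_k,q_{k+1})+D_2\Lambda_{\mathrm d}(q_{k-1},q_k)=0$. Modified Lagrangian: it is a Lagrangian $\Lambda_{\mathrm m}$ such that (formally in $h$) $\Lambda_{\mathrm d}(q_k,q_{k+1})=\int_{t_k}^{t_{k+1}}\Lambda_{\mathrm m}\,dt$, $h=t_{k+1}-t_k$, where $q_k=q(t_k)$, $q_{k+1}=q(t_{k+1})$ and $q$ is a solution of the Euler--Lagrange equation of $\Lambda_{\mathrm m}$. Precisely, let $\Lambda=\sum_{i\ge0}h^{2i}\Lambda_i(q,\dot q)$ be a (possibly finite) formal power series in $h^2$ with smooth coefficients and with $\frac{\partial^2\Lambda_0}{\partial\dot q\partial\dot q}$ invertible. Put $$\mathcal{M}=\Lambda\Big(\sum_{j\ge0}\frac{h^{2j}}{2^{2j}(2j)!}q^{(2j)},\ \sum_{j\ge0}\frac{h^{2j}}{2^{2j}(2j+1)!}q^{(2j+1)}\Big),$$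 Taylor expanded in $h$ about $(q,\dot q)$ (this is the Taylor expansion of $\Lambda_{\mathrm d}/h$ about the midpoint in time), and $$\Lambda_{\mathrm{jet}}=\sum_{i\ge0}h^{2i}(2^{1-2i}-1)\frac{B_{2i}}{(2i)!}\frac{d^{2i}}{dt^{2i}}\mathcal{M},$$ with $B_{2i}$ the Bernoulli numbers and $\frac{d}{dt}$ the total time derivative; its coefficients are functions of $q,\dot q,\ddot q,q^{(3)},\dots$. The modified Lagrangian $\Lambda_{\mathrm m}=\sum_{i\ge0}h^{2i}\Lambda_{\mathrm m,i}(q,\dot q)$ is the unique formal power series that is obtained from $\Lambda_{\mathrm{jet}}$ by eliminating $\ddot q,q^{(3)},\dots$ by means of the Euler--Lagrange equation $\ddot q=\big(\frac{\partial^2\Lambda_{\mathrm m}}{\partial\dot q\partial\dot q}\big)^{-1}\big(\frac{\partial\Lambda_{\mathrm m}}{\partial q}-\frac{\partial^2\Lambda_{\mathrm m}}{\partial q\partial\dot q}\dot q\big)$ of $\Lambda_{\mathrm m}$ itself and its successive total time derivatives (this determines the coefficients recursively in powers of $h^2$, starting from $\Lambda_{\mathrm m,0}=\Lambda_0$). *)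

(* Defs.v *)
(* MathComp-Analysis development, over an abstract realType R. *)
From HB Require Import structures.
From mathcomp Require Import all_boot all_order all_algebra.
From mathcomp Require Import all_classical all_reals all_analysis.

Set Implicit Arguments.
Unset Strict Implicit.
Unset Printing Implicit Defensive.

Import Order.TTheory GRing.Theory Num.Theory.
Import numFieldNormedType.Exports.

Local Open Scope classical_set_scope.
Local Open Scope ring_scope.

(* Every formal power series below is a series in h^2: a series S is the
   sequence of its coefficients, S i being the coefficient of h^(2 * i).  The
   formal variable s stands for h^2. *)

(* Points (q, qdot) of R^n x R^n; vectors of R^n are columns. *)
Notation phase R n := ('cV[R]_n * 'cV[R]_n)%type.

(* Points (q, qdot, q^(2), q^(3), ...) of the infinite jet space. *)
Notation jet R n := (nat -> 'cV[R]_n).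

(* smooth_on A is C^infinity on A, for an open set A: the iterated directional
   derivatives of all orders exist on A and are differentiable (in particular
   continuous) there. *)
Section Smooth.
Variables (R : realType) (V W : normedModType R).

Definition iter_derive (vs : seq V) (f : V -> W) : V -> W :=
  foldr (fun v g => 'D_v g) f vs.

Definition smooth_on (A : set V) (f : V -> W) : Prop :=
  forall (vs : seq V) (x : V), A x -> differentiable (iter_derive vs f) x.

End Smooth.

(* Course-of-values recursion: the n-th term is step [:: u_0; ...; u_(n-1)]. *)
Section StrongRec.
Variables (T : Type) (step : seq T -> T).

Fixpoint strong_rec_seq (n : nat) : seq T :=
  if n is m.+1 then
    let u := strong_rec_seq m in rcons u (step u)
  else [::].

Definition strong_rec (n : nat) : T := step (strong_rec_seq n).

Lemma size_strong_rec_seq n : size (strong_rec_seq n) = n.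
Proof. by elim: n => //= n IHn; rewrite size_rcons IHn. Qed.

Lemma nth_strong_rec_seq x0 n k :
  (k < n)%N -> nth x0 (strong_rec_seq n) k = strong_rec k.
Proof.
elim: n => //= n IHn; rewrite ltnS leq_eqVlt nth_rcons size_strong_rec_seq.
by case/predU1P => [->|kn]; rewrite ?ltnn ?eqxx// kn IHn.
Qed.

End StrongRec.

(* Bernoulli numbers; see bernoulliP. *)
Definition bernoulli (R : realType) : nat -> R :=
  strong_rec (fun u : seq R => let n := size u in
    (n == 0%N)%:R - n.+1%:R^-1 * \sum_(k < n) 'C(n.+1, k)%:R * u`_k).

Lemma bernoulliP (R : realType) n :
  \sum_(k < n.+1) 'C(n.+1, k)%:R * bernoulli R k = (n == 0%N)%:R.
Proof.
rewrite big_ord_recr /= [bernoulli R n]/bernoulli /strong_rec.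
rewrite size_strong_rec_seq binSn mulrBr mulrA mulfV ?pnatr_eq0// mul1r.
under [X in _ - X]eq_bigr => k _ do
  rewrite nth_strong_rec_seq// -[strong_rec _ _]/(bernoulli R k).
rewrite addrCA subrr addr0.
by case: n => [|n] /=; rewrite ?mulr1// mulr0.
Qed.

(* Inverse of a formal power series of square matrices with invertible
   constant term; see mulmx_inv_series. *)
Section InvSeries.
Variables (R : realType) (n : nat).

Definition inv_series (H : nat -> 'M[R]_n) : nat -> 'M[R]_n :=
  strong_rec (fun u : seq 'M[R]_n => let m := size u in
    if m == 0%N then invmx (H 0%N)
    else - (invmx (H 0%N) *m \sum_(i < m) (H i.+1 *m u`_(m - i.+1)))).

Lemma mulmx_inv_series (H : nat -> 'M[R]_n) m : H 0%N \in unitmx ->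
  \sum_(i < m.+1) H i *m inv_series H (m - i) =
  if m == 0%N then 1%:M else 0.
Proof.
move=> H0; rewrite big_ord_recl subn0 [inv_series H m]/inv_series /strong_rec.
rewrite size_strong_rec_seq.
case: m => [|m]; first by rewrite /= big_ord0 addr0 mulmxV.
rewrite /= mulmxN mulmxA mulmxV// mul1mx.
apply/eqP; rewrite addrC subr_eq0; apply/eqP/eq_bigr => i _; congr (_ *m _).
rewrite -[X in X`_ _]/(strong_rec_seq _ m.+1) nth_strong_rec_seq//.
by rewrite subSS ltnS leq_subr.
Qed.

End InvSeries.

(* Coefficient of s^m in the Taylor expansion of f at 0. *)
Definition taylor_coef (R : realType) (m : nat) (f : R -> R) : R :=
  derive1n m f 0 / m`!%:R.

(* Coefficient of s^m in the Taylor expansion about a 0 of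
   sum_i s^i F_i (sum_j s^j a_j).  The terms of order above m in either sum do
   not contribute to it, so both are cut off at order m. *)
Definition subst_series (R : realType) (V : lmodType R)
    (F : nat -> V -> R) (a : nat -> V) (m : nat) : R :=
  taylor_coef m (fun s : R =>
    \sum_(i < m.+1) s ^+ i * F i (\sum_(j < m.+1) s ^+ j *: a j)).

Section ModifiedLagrangian.
Variables (R : realType) (n : nat).

(* The arguments of M are power series in s = h^2, with coefficients
   q^(2j) / (2^(2j) (2j)!) and q^(2j+1) / (2^(2j) (2j+1)!). *)
Definition midpoint_args (x : jet R n) (j : nat) : phase R n :=
  ((2 ^+ (2 * j) * (2 * j)`!%:R)^-1 *: x (2 * j)%N,
   (2 ^+ (2 * j) * (2 * j).+1`!%:R)^-1 *: x (2 * j).+1).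

Definition midpoint_series (Lam : nat -> phase R n -> R)
    (m : nat) (x : jet R n) : R :=
  subst_series Lam (midpoint_args x) m.

(* The total time derivative is the action on functions of finitely many jet
   coordinates of the vector field sum_k q^(k+1) . d/dq^(k), i.e. the
   derivative in the direction (q^(k+1))_k at the jet (q^(k))_k. *)
Definition total_derivative (F : jet R n -> R) (x : jet R n) : R :=
  derive1 (fun t : R => F (fun k => x k + t *: x k.+1)) 0.

Definition lagrangian_jet (Lam : nat -> phase R n -> R)
    (m : nat) (x : jet R n) : R :=
  \sum_(i < m.+1)
    (2 / 2 ^+ (2 * i) - 1) * (bernoulli R (2 * i) / (2 * i)`!%:R) *
    iter (2 * i) total_derivative (midpoint_series Lam (m - i)) x.

Definition partial_q (i : 'I_n) (f : phase R n -> R) : phase R n -> R :=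
  'D_((delta_mx i 0, 0) : phase R n) f.

Definition partial_v (i : 'I_n) (f : phase R n -> R) : phase R n -> R :=
  'D_((0, delta_mx i 0) : phase R n) f.

Definition hessian_v (f : phase R n -> R) (x : phase R n) : 'M[R]_n :=
  \matrix_(i, j) partial_v i (partial_v j f) x.

Definition mixed_qv (f : phase R n -> R) (x : phase R n) : 'M[R]_n :=
  \matrix_(i, j) partial_v i (partial_q j f) x.

Definition gradient_q (f : phase R n -> R) (x : phase R n) : 'cV[R]_n :=
  \col_i partial_q i f x.

(* Right-hand side, as a formal power series, of the Euler-Lagrange equation
   solved for the second derivative of q. *)
Definition acceleration (Lm : nat -> phase R n -> R)
    (m : nat) (x : phase R n) : 'cV[R]_n :=
  \sum_(i < m.+1) inv_series (fun k => hessian_v (Lm k) x) i *m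
    (gradient_q (Lm (m - i)%N) x - mixed_qv (Lm (m - i)%N) x *m x.2).

(* Total time derivative of a series of functions of (q, qdot), with the second
   derivative of q replaced by the series acceleration Lm. *)
Definition derivative_along (Lm : nat -> phase R n -> R)
    (A : nat -> phase R n -> 'cV[R]_n)
    (m : nat) (x : phase R n) : 'cV[R]_n :=
  'D_((x.2, 0) : phase R n) (A m) x +
  \sum_(i < m.+1) 'D_((0, acceleration Lm (m - i) x) : phase R n) (A i) x.

(* q^(k) as a series of functions of (q, qdot), by means of the Euler-Lagrange
   equation of Lm and its successive total time derivatives. *)
Fixpoint on_shell (Lm : nat -> phase R n -> R) (k : nat) :
    nat -> phase R n -> 'cV[R]_n :=
  match k with
  | 0 => fun m x => if m == 0%N then x.1 else 0
  | 1 => fun m x => if m == 0%N then x.2 else 0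
  | 2 => acceleration Lm
  | k'.+1 => derivative_along Lm (on_shell Lm k')
  end.

Definition eliminate (Lm : nat -> phase R n -> R) (F : nat -> jet R n -> R)
    (m : nat) (x : phase R n) : R :=
  subst_series F (fun (j : nat) (k : nat) => on_shell Lm k j x) m.

(* Lm is the modified Lagrangian of the series Lam on U x R^n.  Since
   lagrangian_jet Lam 0 only depends on (q, qdot), the m-th equation expresses
   Lm m in terms of Lm 0, ..., Lm (m - 1) and has Lm 0 = Lam 0 for m = 0. *)
Definition modified_lagrangian (U : set 'cV[R]_n)
    (Lam Lm : nat -> phase R n -> R) : Prop :=
  forall m : nat, smooth_on (U `*` setT) (Lm m) /\
    forall x, (U `*` setT) x -> Lm m x = eliminate Lm (lagrangian_jet Lam) m x.

(* The formal power series L + sum_(1 <= i <= N) h^(2i) (Ls i). *)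
Definition surrogate (L : phase R n -> R) (N : nat)
    (Ls : nat -> phase R n -> R) (i : nat) : phase R n -> R :=
  if i == 0%N then L else if (i <= N)%N then Ls i else fun=> 0.

(* A function of (q, qdot) as a constant series. *)
Definition const_series (L : phase R n -> R) (i : nat) : phase R n -> R :=
  if i == 0%N then L else fun=> 0.

(* Coefficient of h^k in a series in h^2. *)
Definition coef_h (S : nat -> phase R n -> R) (k : nat) : phase R n -> R :=
  if odd k then fun=> 0 else S k./2.

(* A = B + O(h^K) on U x R^n. *)
Definition eq_mod_h (U : set 'cV[R]_n) (K : nat)
    (A B : nat -> phase R n -> R) : Prop :=
  forall k : nat, (k < K)%N ->
    forall x, (U `*` setT) x -> coef_h A k x = coef_h B k x.

End ModifiedLagrangian.

(* Main.v *)
Require Import Defs.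
From HB Require Import structures.
From mathcomp Require Import all_boot all_order all_algebra.
From mathcomp Require Import all_classical all_reals all_analysis.
Import Order.TTheory GRing.Theory Num.Theory.
Import numFieldNormedType.Exports.
Local Open Scope classical_set_scope.
Local Open Scope ring_scope.
Set Implicit Arguments.
Unset Strict Implicit.
Unset Printing Implicit Defensive.

(* The coefficient of s^m in the elimination from Lambda_jet has the form
   Lam m + G m, where G m depends only on the coefficients of Lam and Lm of index
   below m: Lambda_jet,0 is a function of (q, qdot) alone, and in every other
   summand the factor s^i lowers the order to which the on-shell jet is needed.
   Moreover G m is smooth when those coefficients are.  The equations
   Lm m = Lam m + G m are therefore solved recursively, and prescribing Lm = L up
   to order N determines L_m = - G m (with Lm = L) for 1 <= m <= N.  The values of
   the Bernoulli numbers play no role, apart from B_0 = 1. *)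

(** * Smooth functions on normed modules *)

(** The remainder [G m] is never written down. [eliminate_top] says instead that the difference
    between the elimination and [Lam m] stays the same when the series are replaced by others with
    the same lower coefficients. Replacing [Lam] by its truncation below [m] makes the subtracted
    term vanish, so that the elimination of the truncation is [G m] itself; this is where the
    formula for the surrogate terms comes from. The obstacle is that nothing here is formal: a
    coefficient is an iterated derivative at 0 of an actual function of [s], and the Lagrangians are
    controlled only over [U]. Discarding a term of high order therefore becomes a statement about
    derivatives on a neighbourhood of 0. Smoothness of a coefficient in the remaining variables is
    obtained by adjoining [s] as one more variable, differentiating in its direction and restricting
    to [s = 0]. *)

Section SmoothCalculus.
Context {R : realType}.

(** The first-order expansion of [f] at [x] is also one of [g], since only values near [x] enter;
    [diff_unique] then identifies its linear part with the differential of [g]. *)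
Lemma near_eq_differentiable (V W : normedModType R) (f g : V -> W) (x : V) :
  (\near x, f x = g x) -> differentiable f x -> differentiable g x.
Proof.
move=> fg /diff_locallyP[dfc dfx].
have gx0 : f x = g x by apply: nbhs_singleton fg.
have dgx : g \o shift x = cst (g x) + 'd f x +o_ 0 id.
  apply/eqaddoP => _/posnumP[e].
  have /eqaddoP /(_ e%:num) /(_ [gt0 of e%:num]) := dfx.
  apply: filter_app.
  have : \forall y \near (0 : V), f (y + x) = g (y + x).
    by move: fg; rewrite (near_shift 0)/= subr0.
  apply: filterS => y /= fgy.
  by rewrite /= !fctE /= fgy gx0.
have dgE := diff_unique dfc dgx.
apply/diff_locallyP; split; first by rewrite dgE.
by rewrite dgE.
Qed.

(** Smoothness graded by order. Product, quotient and chain rules return the original functions next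
    to their derivatives, so the inductions run on an order [k] that may be lowered, rather than on
    a fixed list of directions. *)
Fixpoint Ck (V W : normedModType R) (k : nat) (A : set V) (f : V -> W) : Prop :=
  (forall x, A x -> differentiable f x) /\
  if k is k'.+1 then forall v, Ck k' A ('D_v f) else True.

Lemma open_near (T : topologicalType) (A : set T) (P : T -> Prop) (x : T) :
  open A -> A x -> (forall y, A y -> P y) -> \near x, P x.
Proof.
by move=> oA Ax AP; apply: filterS (open_nbhs_nbhs (conj oA Ax)).
Qed.

Lemma open_derive_eq (V W : normedModType R) (A : set V) (f g : V -> W) v :
  open A -> (forall x, A x -> f x = g x) ->
  forall x, A x -> 'D_v f x = 'D_v g x.
Proof. by move=> oA fg x Ax; apply: near_eq_derive; exact: open_near Ax fg. Qed.

Lemma eq_Ck (V W : normedModType R) k (A : set V) (f g : V -> W) :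
  open A -> (forall x, A x -> f x = g x) -> Ck k A f -> Ck k A g.
Proof.
move=> oA; elim: k f g => [|k IH] f g fg /= [df Df].
  by split=> // x Ax; apply: near_eq_differentiable (df x Ax); exact: open_near Ax fg.
split=> [x Ax|v]; first by apply: near_eq_differentiable (df x Ax); exact: open_near Ax fg.
by apply: IH (Df v); exact: open_derive_eq.
Qed.

Lemma Ck_differentiable (V W : normedModType R) k (A : set V) (f : V -> W) :
  Ck k A f -> forall x, A x -> differentiable f x.
Proof. by case: k => [|k] []. Qed.

Lemma CkS (V W : normedModType R) k (A : set V) (f : V -> W) :
  Ck k.+1 A f -> Ck k A f.
Proof.
elim: k f => [|k IH] f [df Df]; split=> // v.
exact: IH.
Qed.

Lemma smooth_onP (V W : normedModType R) (A : set V) (f : V -> W) :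
  smooth_on A f <-> forall k, Ck k A f.
Proof.
split=> [sf k|Cf vs x Ax].
  elim: k f sf => [|k IH] f sf; split=> //; try by move=> x Ax; exact: (sf [::]).
  (* [iter_derive] applies the last direction of the list first, so the derivative taken innermost
     is appended at the end. *)
  move=> v; apply: IH => vs x Ax; have := sf (rcons vs v) x Ax.
  by rewrite /iter_derive foldr_rcons.
suff : forall k, Ck k A (iter_derive vs f).
  by move=> /(_ 0%N) /Ck_differentiable; apply.
by elim: vs => //= v vs IH k; have [_] := IH k.+1; apply.
Qed.

Lemma eq_smooth_on (V W : normedModType R) (A : set V) (f g : V -> W) :
  open A -> (forall x, A x -> f x = g x) -> smooth_on A f -> smooth_on A g.
Proof.
by move=> oA fg /smooth_onP sf; apply/smooth_onP => k; apply: eq_Ck oA fg (sf k).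
Qed.

Lemma smooth_on_derive (V W : normedModType R) (A : set V) (f : V -> W) v :
  smooth_on A f -> smooth_on A ('D_v f).
Proof.
by move=> /smooth_onP sf; apply/smooth_onP => k; have [_] := sf k.+1; apply.
Qed.

Lemma smooth_on_iter_derive (V W : normedModType R) (A : set V) (f : V -> W) vs :
  smooth_on A f -> smooth_on A (iter_derive vs f).
Proof. by move=> sf; elim: vs => //= v vs; exact: smooth_on_derive. Qed.

Lemma smooth_on_differentiable (V W : normedModType R) (A : set V) (f : V -> W) x :
  smooth_on A f -> A x -> differentiable f x.
Proof. by move=> sf; exact: (sf [::]). Qed.

Lemma smooth_on_derivable (V W : normedModType R) (A : set V) (f : V -> W) x v :
  smooth_on A f -> A x -> derivable f x v.
Proof. by move=> sf Ax; apply/diff_derivable/(smooth_on_differentiable sf). Qed.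

Lemma sub_smooth_on (V W : normedModType R) (A B : set V) (f : V -> W) :
  A `<=` B -> smooth_on B f -> smooth_on A f.
Proof. by move=> AB sf vs x /AB; exact: sf. Qed.

Lemma smooth_on_cst (V W : normedModType R) (A : set V) (c : W) :
  smooth_on A (cst c).
Proof.
apply/smooth_onP => k; elim: k c => [|k IH] c; split=> // v.
have -> : 'D_v (cst c : V -> W) = cst 0 by apply/funext => x; rewrite derive_cst.
exact: IH.
Qed.

Lemma Ck_add (V W : normedModType R) k (A : set V) (f g : V -> W) :
  open A -> Ck k A f -> Ck k A g -> Ck k A (fun x => f x + g x).
Proof.
move=> oA; elim: k f g => [|k IH] f g [df Df] [dg Dg].
  by split=> // x Ax; apply: differentiableD; [exact: df|exact: dg].
split=> [x Ax|v]; first by apply: differentiableD; [exact: df|exact: dg].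
apply: eq_Ck (IH _ _ (Df v) (Dg v)) => // x Ax.
by rewrite -deriveD//; apply: diff_derivable; [exact: df|exact: dg].
Qed.

Lemma smooth_on_add (V W : normedModType R) (A : set V) (f g : V -> W) :
  open A -> smooth_on A f -> smooth_on A g -> smooth_on A (fun x => f x + g x).
Proof.
by move=> oA /smooth_onP sf /smooth_onP sg; apply/smooth_onP => k; exact: Ck_add.
Qed.

Lemma Ck_sum (V W : normedModType R) k (A : set V) (I : Type) (r : seq I)
    (P : pred I) (f : I -> V -> W) :
  open A -> (forall i, P i -> Ck k A (f i)) ->
  Ck k A (fun x => \sum_(i <- r | P i) f i x).
Proof.
move=> oA sf; elim: r => [|i r IH].
  by under eq_fun do rewrite big_nil; exact: (smooth_onP _ _).1 (smooth_on_cst _) k.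
under eq_fun do rewrite big_cons.
have [Pi|_] := boolP (P i); last exact: IH.
by apply: Ck_add => //; exact: sf.
Qed.

Lemma smooth_on_sum (V W : normedModType R) (A : set V) (I : Type) (r : seq I)
    (P : pred I) (f : I -> V -> W) :
  open A -> (forall i, P i -> smooth_on A (f i)) ->
  smooth_on A (fun x => \sum_(i <- r | P i) f i x).
Proof.
move=> oA sf; apply/smooth_onP => k; apply: Ck_sum => // i Pi.
by have /smooth_onP := sf i Pi.
Qed.

Lemma Ck_mul (V : normedModType R) k (A : set V) (f g : V -> R) :
  open A -> Ck k A f -> Ck k A g -> Ck k A (fun x => f x * g x).
Proof.
move=> oA; elim: k f g => [|k IH] f g Cf Cg.
  by split=> // x Ax; apply: differentiableM; [apply: Cf.1|apply: Cg.1].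
split=> [x Ax|v]; first by apply: differentiableM; [apply: Cf.1|apply: Cg.1].
apply: (@eq_Ck _ _ _ _ (fun x => f x * 'D_v g x + g x * 'D_v f x)) => //.
  move=> x Ax; rewrite deriveM//; apply: diff_derivable;
    [exact: Cf.1|exact: Cg.1].
by apply: Ck_add => //; apply: IH; [exact: CkS|exact: Cg.2|exact: CkS|exact: Cf.2].
Qed.

Lemma smooth_on_mul (V : normedModType R) (A : set V) (f g : V -> R) :
  open A -> smooth_on A f -> smooth_on A g -> smooth_on A (fun x => f x * g x).
Proof.
by move=> oA /smooth_onP sf /smooth_onP sg; apply/smooth_onP => k; exact: Ck_mul.
Qed.

Lemma smooth_on_prod (V : normedModType R) (A : set V) (I : Type) (r : seq I)
    (P : pred I) (f : I -> V -> R) :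
  open A -> (forall i, P i -> smooth_on A (f i)) ->
  smooth_on A (fun x => \prod_(i <- r | P i) f i x).
Proof.
move=> oA sf; elim: r => [|i r IH].
  by under eq_fun do rewrite big_nil; exact: smooth_on_cst.
under eq_fun do rewrite big_cons.
have [Pi|_] := boolP (P i); last exact: IH.
by apply: smooth_on_mul => //; exact: sf.
Qed.

(** The derivative of the inverse is a product of two inverses and a derivative of [f], hence
    involves the inverse only at the lower order. *)
Lemma Ck_inv (V : normedModType R) k (A : set V) (f : V -> R) :
  open A -> (forall x, A x -> f x != 0) -> Ck k A f -> Ck k A (fun x => (f x)^-1).
Proof.
move=> oA f0; elim: k => [|k IH] Cf.
  by split=> // x Ax; apply: differentiableV; [apply: Cf.1|exact: f0].
split=> [x Ax|v]; first by apply: differentiableV; [apply: Cf.1|exact: f0].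
apply: (@eq_Ck _ _ _ _ (fun x => -1 * ((f x)^-1 * (f x)^-1) * 'D_v f x)) => //.
  move=> x Ax; rewrite deriveV ?f0//; last exact/diff_derivable/Cf.1.
  by rewrite mulN1r [_ *: _]/(_ * _) expr2 invfM.
apply: Ck_mul => //; last exact: Cf.2.
apply: Ck_mul => //; first exact: (smooth_onP _ _).1 (smooth_on_cst _) k.
by apply: Ck_mul => //; apply: IH; exact: CkS.
Qed.

Lemma smooth_on_inv (V : normedModType R) (A : set V) (f : V -> R) :
  open A -> (forall x, A x -> f x != 0) -> smooth_on A f ->
  smooth_on A (fun x => (f x)^-1).
Proof.
by move=> oA f0 /smooth_onP sf; apply/smooth_onP => k; exact: Ck_inv.
Qed.

(** A predicate on bare functions, so that projections, injections and matrix coordinates can be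
    used as plain [fun] terms. *)
Definition bounded_linear (V W : normedModType R) (l : V -> W) :=
  linear l /\ continuous l.

Lemma bounded_linear_diff (V W : normedModType R) (l : V -> W) (x : V) :
  bounded_linear l -> differentiable l x /\ 'd l x = l :> (V -> W).
Proof.
move=> [ll cl].
pose lM := GRing.isLinear.Build _ _ _ _ l ll.
pose lL : {linear V -> W} := HB.pack l lM.
have cL : continuous lL by [].
by split; [exact: (linear_differentiable x cL)|exact: (diff_lin x cL)].
Qed.

Lemma bounded_linear_derive (V W Z : normedModType R) (l : W -> Z) (f : V -> W) x v :
  bounded_linear l -> differentiable f x ->
  'D_v (fun y => l (f y)) x = l ('D_v f x).
Proof.
move=> bl df; have [dl El] := bounded_linear_diff (f x) bl.
rewrite -[fun y => _]/(l \o f) !deriveE//; last exact: differentiable_comp.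
by rewrite (diff_comp df dl)/= El.
Qed.

Lemma Ck_postlinear (V W Z : normedModType R) k (A : set V) (l : W -> Z) (f : V -> W) :
  open A -> bounded_linear l -> Ck k A f -> Ck k A (fun y => l (f y)).
Proof.
move=> oA bl.
have dl (g : V -> W) x : differentiable g x -> differentiable (fun y => l (g y)) x.
  by move=> dg; apply: (differentiable_comp dg); have [] := bounded_linear_diff (g x) bl.
elim: k f => [|k IH] f [df Df].
  by split=> // x Ax; apply: (dl f); exact: df.
split=> [x Ax|v]; first by apply: (dl f); exact: df.
apply: eq_Ck (IH _ (Df v)) => // x Ax.
by rewrite (bounded_linear_derive v bl (df x Ax)).
Qed.

Lemma smooth_on_postlinear (V W Z : normedModType R) (A : set V) (l : W -> Z) (f : V -> W) :
  open A -> bounded_linear l -> smooth_on A f -> smooth_on A (fun y => l (f y)).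
Proof.
by move=> oA bl /smooth_onP sf; apply/smooth_onP => k; exact: Ck_postlinear.
Qed.

(** The derivative of [f] after [l] in the direction [v] is the derivative of [f] in the fixed
    direction [l v], again after [l]; the induction replaces [f] by that derivative. *)
Lemma smooth_on_prelinear (V W Z : normedModType R) (A : set W) (B : set V)
    (l : V -> W) (f : W -> Z) :
  open B -> (forall y, B y -> A (l y)) -> bounded_linear l -> smooth_on A f ->
  smooth_on B (fun y => f (l y)).
Proof.
move=> oB BA bl /smooth_onP sf; apply/smooth_onP => k.
have dl (g : W -> Z) x : differentiable g (l x) -> differentiable (fun y => g (l y)) x.
  by move=> dg; apply: differentiable_comp => //; have [] := bounded_linear_diff x bl.
elim: k f sf => [|k IH] f sf.
  by split=> // x Bx; apply/dl/(Ck_differentiable (sf 0%N))/BA.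
split=> [x Bx|v]; first by apply/dl/(Ck_differentiable (sf 0%N))/BA.
apply: (@eq_Ck _ _ _ _ (fun y => 'D_(l v) f (l y))) => //; last first.
  by apply: (IH ('D_(l v) f)) => j; have [_] := sf j.+1; apply.
move=> x Bx; have [dlx El] := bounded_linear_diff x bl.
have df : differentiable f (l x) by exact/(Ck_differentiable (sf 0%N))/BA.
rewrite -[fun y => f (l y)]/(f \o l) !deriveE//; last exact: differentiable_comp.
by rewrite (diff_comp dlx df)/= El.
Qed.

(* A finite frame of W; it turns the differential of a function on W into a
   finite combination of directional derivatives along fixed vectors. *)
Definition framed (W : normedModType R) :=
  exists (I : finType) (e : I -> W) (c : I -> W -> R),
    (forall i, bounded_linear (c i)) /\ forall w, w = \sum_i c i w *: e i.

Lemma Ck_comp (V W Z : normedModType R) k (A : set V) (B : set W)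
    (g : W -> R) (f : V -> W) :
  framed W -> open A -> open B -> (forall x, A x -> B (f x)) ->
  Ck k B g -> Ck k A f -> Ck k A (fun x => g (f x)).
Proof.
move=> [I [e [c [bc fr]]]] oA oB AB.
elim: k g f AB => [|k IH] g f AB Cg Cf.
  split=> // x Ax; apply: differentiable_comp; [exact: Cf.1|apply: Cg.1].
  exact: AB.
split=> [x Ax|v].
  apply: differentiable_comp; [exact: Cf.1|apply: Cg.1]; exact: AB.
apply: (@eq_Ck _ _ _ _ (fun x => \sum_i c i ('D_v f x) * 'D_(e i) g (f x))) => //.
  move=> x Ax; have df := Cf.1 x Ax; have dg := Cg.1 _ (AB _ Ax).
  rewrite -[fun x => g (f x)]/(g \o f) [RHS]deriveE//; last exact: differentiable_comp.
  rewrite (diff_comp df dg)/= -(deriveE _ df) [in RHS](fr ('D_v f x)) linear_sum/=.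
  by apply: eq_bigr => i _; rewrite linearZ/= -deriveE.
apply: Ck_sum => // i _; apply: Ck_mul => //.
  by apply: (@Ck_postlinear _ _ _ _ _ (c i)) => //; exact: Cf.2.
by apply: (IH ('D_(e i) g) f) => //; [exact: Cg.2|exact: CkS].
Qed.

Lemma smooth_on_comp (V W : normedModType R) (A : set V) (B : set W)
    (g : W -> R) (f : V -> W) :
  framed W -> open A -> open B -> (forall x, A x -> B (f x)) ->
  smooth_on B g -> smooth_on A f -> smooth_on A (fun x => g (f x)).
Proof.
move=> fr oA oB AB /smooth_onP sg /smooth_onP sf; apply/smooth_onP => k.
exact: Ck_comp AB (sg k) (sf k).
Qed.

End SmoothCalculus.

(** * Frames, matrix-valued functions, and smoothness of Taylor coefficients in parameters *)

Section Frames.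
Context {R : realType}.

Lemma bounded_linear_fst (V W : normedModType R) :
  bounded_linear (fun z : (V * W)%type => z.1).
Proof. by split=> [//|z]; exact: cvg_fst. Qed.

Lemma bounded_linear_snd (V W : normedModType R) :
  bounded_linear (fun z : (V * W)%type => z.2).
Proof. by split=> [//|z]; exact: cvg_snd. Qed.

Lemma bounded_linear_inl (V W : normedModType R) :
  bounded_linear (fun v : V => (v, 0) : (V * W)%type).
Proof.
split=> [k u v|v]; last by apply: cvg_pair; [exact: cvg_id|exact: cvg_cst].
by rewrite -[RHS]/(k *: u + v, k *: 0 + 0) scaler0 addr0.
Qed.

Lemma bounded_linear_inr (V W : normedModType R) :
  bounded_linear (fun w : W => (0, w) : (V * W)%type).
Proof.
split=> [k u v|v]; last by apply: cvg_pair; [exact: cvg_cst|exact: cvg_id].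
by rewrite -[RHS]/(k *: 0 + 0, k *: u + v) scaler0 addr0.
Qed.

Lemma bounded_linear_coord m n i j :
  bounded_linear (fun M : 'M[R]_(m, n) => M i j).
Proof. by split=> [k u v|]; [rewrite !mxE|exact: coord_continuous]. Qed.

Lemma bounded_linear_scalel (W : normedModType R) (w : W) :
  bounded_linear (fun k : R => k *: w).
Proof.
by split=> [k u v|]; [rewrite scalerDl scalerA|exact: scalel_continuous].
Qed.

Lemma bounded_linear_id (W : normedModType R) : bounded_linear (@id W).
Proof. by split=> [k u v|v] //; exact: cvg_id. Qed.

Lemma bounded_linear_comp (V W Z : normedModType R) (f : W -> Z) (g : V -> W) :
  bounded_linear f -> bounded_linear g -> bounded_linear (fun x => f (g x)).
Proof.
move=> [lf cf] [lg cg]; split=> [k u v|x]; first by rewrite lg lf.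
by apply: continuous_comp; [exact: cg|exact: cf].
Qed.

Lemma bounded_linear_smooth (V W : normedModType R) (A : set V) (l : V -> W) :
  open A -> bounded_linear l -> smooth_on A l.
Proof.
move=> oA bl; apply/smooth_onP => k.
have sid : forall k, Ck k A (@id V).
  have did (x : V) : differentiable (@id V) x by [].
  case=> [|k']; split; do ?by [].
  move=> v; have -> : 'D_v (@id V) = cst v by apply/funext => x; rewrite derive_id.
  exact: (smooth_onP _ _).1 (smooth_on_cst _) k'.
exact: Ck_postlinear bl (sid k).
Qed.

Lemma framed_scalar : framed R.
Proof.
exists unit, (fun=> 1), (fun=> id); split=> [_|w]; first exact: bounded_linear_id.
by rewrite big_const card_unit/= addr0 [_ *: _]mulr1.
Qed.

Lemma framed_pair (V W : normedModType R) :
  framed V -> framed W -> framed (V * W)%type.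
Proof.
move=> [I [e [c [bc fr]]]] [J [e' [c' [bc' fr']]]].
exists (I + J)%type,
  (fun i => match i with inl i => (e i, 0) | inr j => (0, e' j) end),
  (fun i w => match i with inl i => c i w.1 | inr j => c' j w.2 end).
split=> [[i|j]|[v w]].
- exact: (bounded_linear_comp (bc i) (bounded_linear_fst _ _)).
- exact: (bounded_linear_comp (bc' j) (bounded_linear_snd _ _)).
rewrite big_sumType/=.
have El : \sum_i c i v *: ((e i, 0) : V * W) = (v, 0).
  rewrite [in RHS](fr v).
  elim/big_rec2 : _ => // i x y _ ->.
  by rewrite -[LHS]/(_ , c i v *: 0 + 0) scaler0 addr0.
have Er : \sum_j c' j w *: ((0, e' j) : V * W) = (0, w).
  rewrite [in RHS](fr' w).
  elim/big_rec2 : _ => // i x y _ ->.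
  by rewrite -[LHS]/(c' i w *: 0 + 0, _) scaler0 addr0.
by rewrite El Er -[RHS]/(v + 0, 0 + w) addr0 add0r.
Qed.

Lemma framed_cV n : framed 'cV[R]_n.
Proof.
exists 'I_n, (fun i => delta_mx i 0), (fun i (w : 'cV[R]_n) => w i 0).
split=> [i|w]; first exact: bounded_linear_coord.
by rewrite [LHS]matrix_sum_delta; apply: eq_bigr => i _; rewrite big_ord1.
Qed.

Lemma framed_phase n : framed (phase R n).
Proof. exact: framed_pair (framed_cV n) (framed_cV n). Qed.

Lemma smooth_on_scale (V W : normedModType R) (A : set V) (g : V -> R) (f : V -> W) :
  framed W -> open A -> smooth_on A g -> smooth_on A f ->
  smooth_on A (fun x => g x *: f x).
Proof.
move=> [I [e [c [bc fr]]]] oA sg sf.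
have -> : (fun x => g x *: f x) = (fun x => \sum_i (g x * c i (f x)) *: e i).
  apply/funext => x; rewrite [in LHS](fr (f x)) scaler_sumr.
  by apply: eq_bigr => i _; rewrite scalerA.
apply: smooth_on_sum => // i _.
apply: (smooth_on_postlinear (f := fun x => g x * c i (f x)) oA
  (bounded_linear_scalel (e i))).
by apply: smooth_on_mul => //; exact: smooth_on_postlinear.
Qed.

Lemma smooth_on_pair (V W Z : normedModType R) (A : set V) (f : V -> W) (g : V -> Z) :
  open A -> smooth_on A f -> smooth_on A g -> smooth_on A (fun x => (f x, g x)).
Proof.
move=> oA sf sg.
have -> : (fun x => (f x, g x)) = (fun x => ((f x, 0) : W * Z) + (0, g x)).
  by apply/funext => x; rewrite -[RHS]/(f x + 0, 0 + g x) addr0 add0r.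
apply: smooth_on_add => //.
  exact: (smooth_on_postlinear oA (bounded_linear_inl _ _)).
exact: (smooth_on_postlinear oA (bounded_linear_inr _ _)).
Qed.

Lemma smooth_on_coord (V : normedModType R) m n (A : set V) (f : V -> 'M[R]_(m, n)) i j :
  open A -> smooth_on A f -> smooth_on A (fun x => f x i j).
Proof. by move=> oA; exact: (smooth_on_postlinear oA (bounded_linear_coord i j)). Qed.

Lemma smooth_on_mx (V : normedModType R) m n (A : set V) (f : V -> 'M[R]_(m, n)) :
  open A -> (forall i j, smooth_on A (fun x => f x i j)) -> smooth_on A f.
Proof.
move=> oA sf.
have -> : f = (fun x => \sum_i \sum_j f x i j *: delta_mx i j).
  by apply/funext => x; rewrite [LHS]matrix_sum_delta.
do 2 (apply: smooth_on_sum => // ? _).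
exact: (smooth_on_postlinear oA (bounded_linear_scalel _)).
Qed.

Lemma smooth_on_opp (V W : normedModType R) (A : set V) (f : V -> W) :
  open A -> smooth_on A f -> smooth_on A (fun x => - f x).
Proof.
move=> oA; apply: (smooth_on_postlinear oA (l := -%R)).
split=> [k u v|]; last exact: opp_continuous.
by rewrite opprD scalerN.
Qed.

Lemma smooth_on_mulmx (V : normedModType R) m n p (A : set V)
    (f : V -> 'M[R]_(m, n)) (g : V -> 'M[R]_(n, p)) :
  open A -> smooth_on A f -> smooth_on A g -> smooth_on A (fun x => f x *m g x).
Proof.
move=> oA sf sg; apply: smooth_on_mx => // i j.
under eq_fun do rewrite mxE.
by apply: smooth_on_sum => // k _; apply: smooth_on_mul => //; exact: smooth_on_coord.
Qed.

Lemma smooth_on_det (V : normedModType R) n (A : set V) (f : V -> 'M[R]_n) :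
  open A -> (forall i j, smooth_on A (fun x => f x i j)) ->
  smooth_on A (fun x => \det (f x)).
Proof.
move=> oA sf; rewrite /determinant; apply: smooth_on_sum => // s _.
apply: smooth_on_mul => //; first exact: smooth_on_cst.
exact: smooth_on_prod.
Qed.

Lemma smooth_on_invmx (V : normedModType R) n (A : set V) (f : V -> 'M[R]_n) :
  open A -> (forall x, A x -> f x \in unitmx) -> smooth_on A f ->
  smooth_on A (fun x => invmx (f x)).
Proof.
move=> oA fu sf.
have sfc i j : smooth_on A (fun x => f x i j) by exact: smooth_on_coord.
apply: smooth_on_mx => // i j.
(* Cramer's rule: the entries of the inverse are cofactors, polynomial in the entries of [f x],
   divided by the determinant. *)
apply: (@eq_smooth_on _ _ _ _ (fun x => (\det (f x))^-1 *
    ((-1) ^+ (j + i) * \det (row' j (col' i (f x)))))) => //.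
  by move=> x Ax; rewrite /invmx fu// !mxE.
apply: (smooth_on_mul oA).
  apply: (smooth_on_inv oA); last exact: smooth_on_det.
  by move=> x /fu; rewrite unitmxE unitfE.
apply: (smooth_on_mul oA); first exact: smooth_on_cst.
apply: (smooth_on_det oA) => i' j'.
under eq_fun do rewrite !mxE; exact: sfc.
Qed.

Lemma smooth_on_exp (V : normedModType R) (A : set V) (f : V -> R) k :
  open A -> smooth_on A f -> smooth_on A (fun x => f x ^+ k).
Proof.
move=> oA sf; elim: k => [|k IH]; first exact: smooth_on_cst.
by under eq_fun do rewrite exprS; exact: smooth_on_mul.
Qed.

Lemma open_smooth_preimage (V W : normedModType R) (A : set V) (U : set W) (f : V -> W) :
  open A -> open U -> smooth_on A f -> open (A `&` f @^-1` U).
Proof.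
move=> oA oU sf; rewrite openE => x [Ax Ufx]; rewrite /interior.
apply: filterI; first exact: open_nbhs_nbhs.
apply: (differentiable_continuous (smooth_on_differentiable sf Ax)).
exact: open_nbhs_nbhs.
Qed.

Lemma open_fst (V W : normedModType R) (A : set V) :
  open A -> open [set z : (V * W)%type | A z.1].
Proof. by move=> oA; apply: open_comp => // z _; exact: cvg_fst. Qed.

Lemma smooth_on_param (V W Z : normedModType R) (A : set V) (f : V -> Z) :
  open A -> smooth_on A f ->
  smooth_on [set z : (V * W)%type | A z.1] (fun z : (V * W)%type => f z.1).
Proof.
move=> oA sf; apply: (smooth_on_prelinear _ _ (bounded_linear_fst _ _) sf) => //.
exact: open_fst.
Qed.

(** Both derivatives are limits of one and the same difference quotient. *)
Lemma derive_slice (V W : normedModType R) (g : (V * R)%type -> W) (y : V) (s : R) :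
  'D_1 (fun s => g (y, s)) s = 'D_((0, 1) : V * R) g (y, s).
Proof.
rewrite /derive.
suff -> : (fun h : R => h^-1 *: (((fun s => g (y, s)) \o shift s) (h *: 1) - g (y, s))) =
  (fun h => h^-1 *: ((g \o shift (y, s)) (h *: ((0, 1) : V * R)) - g (y, s))) by [].
apply/funext => h /=.
by rewrite -[(h *: ((0, 1) : V * R) + _)]/(h *: 0 + y, h *: 1 + s) scaler0 add0r.
Qed.

Lemma near_slice (V : normedModType R) (A : set (V * R)%type) (y : V) (s : R) :
  open A -> A (y, s) -> \near s, A (y, s).
Proof.
move=> oA Ays; have cy : (fun t : R => (y, t)) @ s --> (y, s).
  exact: (cvg_pair (cvg_cst y) cvg_id).
exact: (cy _ (open_nbhs_nbhs (conj oA Ays))).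
Qed.

Lemma derive1n_slice (V : normedModType R) (A : set (V * R)%type)
    (f : (V * R)%type -> R) m (y : V) (s : R) :
  open A -> A (y, s) ->
  derive1n m (fun s => f (y, s)) s = iter_derive (nseq m ((0, 1) : V * R)) f (y, s).
Proof.
move=> oA; elim: m s => // m IH s Ays.
rewrite derive1nS derive1E/= -derive_slice; apply: near_eq_derive.
by apply: filterS (near_slice oA Ays) => t Ayt; exact: (IH t).
Qed.

Lemma smooth_on_slice (V W : normedModType R) (A : set (V * R)%type) (B : set V)
    (f : (V * R)%type -> W) :
  open B -> (forall y, B y -> A (y, 0)) -> smooth_on A f ->
  smooth_on B (fun y => f (y, 0)).
Proof.
move=> oB BA; exact: (smooth_on_prelinear oB BA (bounded_linear_inl _ _)).
Qed.

(** With [s] as an extra variable, the coefficient is an iterated derivative in the direction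
    [(0, 1)] of a jointly smooth function, restricted to the slice [s = 0]. This is the source of
    smoothness for every coefficient produced by [subst_series]. *)
Lemma smooth_on_taylor_coef (V : normedModType R) (A : set (V * R)%type) (B : set V)
    (f : (V * R)%type -> R) m :
  open A -> open B -> (forall y, B y -> A (y, 0)) -> smooth_on A f ->
  smooth_on B (fun y => taylor_coef m (fun s => f (y, s))).
Proof.
move=> oA oB BA sf.
apply: (@eq_smooth_on _ _ _ _
  (fun y => iter_derive (nseq m ((0, 1) : V * R)) f (y, 0) * (m`!%:R)^-1)) => //.
  by move=> y By; rewrite /taylor_coef (derive1n_slice _ _ oA)//; exact: BA.
apply: (smooth_on_mul oB); last exact: smooth_on_cst.
exact: (smooth_on_slice oB BA (smooth_on_iter_derive _ sf)).
Qed.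

Lemma smooth_on_derive1_slice (V : normedModType R) (A : set (V * R)%type) (B : set V)
    (f : (V * R)%type -> R) :
  open B -> (forall y, B y -> A (y, 0)) -> smooth_on A f ->
  smooth_on B (fun y => derive1 (fun s => f (y, s)) 0).
Proof.
move=> oB BA sf.
apply: (@eq_smooth_on _ _ _ _ (fun y => 'D_((0, 1) : V * R) f (y, 0))) => //.
  by move=> y By; rewrite derive1E derive_slice.
exact: (smooth_on_slice oB BA (smooth_on_derive _ sf)).
Qed.

End Frames.

(** * Smooth functions of jets *)

Section Jets.
Context {R : realType} {n : nat} (U : set 'cV[R]_n) (hU : open U).

Lemma open_phase : open (U `*` setT : set (phase R n)).
Proof.
suff -> : (U `*` setT : set (phase R n)) = [set z | U z.1] by exact: open_fst.
by apply/seteqP; split=> z //= [].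
Qed.

(* Jets carry no norm, so smoothness of a function of jets is tested on the
   families of jets over U that are smooth coordinatewise.  This is stable under
   total_derivative, which is the t-derivative of the family
   (x_k + t x_(k+1))_k. *)
Definition smooth_jet (F : jet R n -> R) :=
  forall (V : normedModType R) (O : set V) (p : V -> jet R n),
    open O -> (forall k, smooth_on O (fun y => p y k)) ->
    (forall y, O y -> U (p y 0%N)) -> smooth_on O (fun y => F (p y)).

Lemma smooth_jet_total_derivative F :
  smooth_jet F -> smooth_jet (total_derivative F).
Proof.
move=> sF V O p oO sp Up.
pose P (z : (V * R)%type) : jet R n := fun k => p z.1 k + z.2 *: p z.1 k.+1.
have oO' : open [set z : (V * R)%type | O z.1] by exact: open_fst.
have sP k : smooth_on [set z : (V * R)%type | O z.1] (fun z => P z k).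
  apply: (smooth_on_add oO'); first exact: (smooth_on_param oO (sp k)).
  apply: (smooth_on_scale (framed_cV n) oO').
    exact: bounded_linear_smooth (bounded_linear_snd _ _).
  exact: (smooth_on_param oO (sp k.+1)).
(* [F] is controlled only at jets over [U], so the time is restricted to those values that keep the
   base point in [U]; the slice at time 0 lies in this open set. *)
pose A := [set z : (V * R)%type | O z.1] `&` (fun z => P z 0%N) @^-1` U.
have oA : open A by exact: open_smooth_preimage.
apply: (smooth_on_derive1_slice (A := A) (f := fun z => F (P z))) => //.
  by move=> y Oy; split=> //=; rewrite /P/= scale0r addr0; exact: Up.
apply: sF => // [k|z []//].
by apply: sub_smooth_on (sP k) => z [].
Qed.

Lemma smooth_jet_iter_total_derivative k F :
  smooth_jet F -> smooth_jet (iter k (@total_derivative R n) F).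
Proof. by move=> sF; elim: k => //= k; exact: smooth_jet_total_derivative. Qed.

(** Rests on [0 ^+ 0 = 1]. It shows that the curves substituted into the series start at their
    zeroth coefficient, which places them over [U] near [s = 0]. *)
Lemma sum_expr0 (V : lmodType R) m (a : nat -> V) :
  \sum_(j < m.+1) (0 : R) ^+ j *: a j = a 0%N.
Proof.
rewrite big_ord_recl expr0 scale1r big1 ?addr0// => i _.
by rewrite exprS mul0r scale0r.
Qed.

Lemma sum_jetE m (s : R) (a : nat -> jet R n) k :
  (\sum_(j < m) s ^+ j *: a j) k = \sum_(j < m) s ^+ j *: a j k.
Proof. by rewrite fct_sumE. Qed.

Lemma smooth_on_power_sum (V W : normedModType R) (O : set V) m (a : nat -> V -> W) :
  framed W -> open O -> (forall j, smooth_on O (a j)) ->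
  smooth_on [set z : (V * R)%type | O z.1] (fun z => \sum_(j < m) z.2 ^+ j *: a j z.1).
Proof.
move=> fr oO sa; have oO' := @open_fst R V R _ oO.
apply: (smooth_on_sum _ oO') => j _; apply: (smooth_on_scale fr oO').
  apply: (smooth_on_exp _ oO'); exact: bounded_linear_smooth (bounded_linear_snd _ _).
exact: smooth_on_param.
Qed.

Lemma smooth_on_subst_phase (V : normedModType R) (O : set V)
    (F : nat -> phase R n -> R) (a : nat -> V -> phase R n) m :
  open O -> (forall i, smooth_on (U `*` setT) (F i)) ->
  (forall j, smooth_on O (a j)) -> (forall y, O y -> U (a 0%N y).1) ->
  smooth_on O (fun y => subst_series F (a^~ y) m).
Proof.
move=> oO sF sa Ua.
pose P (z : (V * R)%type) := \sum_(j < m.+1) z.2 ^+ j *: a j z.1.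
have P0 y : P (y, 0) = a 0%N y := sum_expr0 m (a^~ y).
have oO' := @open_fst R V R _ oO.
have sP : smooth_on [set z : (V * R)%type | O z.1] P.
  by apply: smooth_on_power_sum => //; exact: framed_phase.
pose A := [set z : (V * R)%type | O z.1] `&` P @^-1` (U `*` setT).
have oA : open A by apply: open_smooth_preimage => //; exact: open_phase.
apply: (smooth_on_taylor_coef (A := A)
  (f := fun z => \sum_(i < m.+1) z.2 ^+ i * F i (P z))) => //.
  by move=> y Oy; split=> //=; split=> //=; rewrite P0; exact: Ua.
apply: (smooth_on_sum _ oA) => i _; apply: (smooth_on_mul oA).
  apply: (smooth_on_exp _ oA); exact: bounded_linear_smooth (bounded_linear_snd _ _).
apply: (smooth_on_comp (framed_phase n) oA open_phase) (sF i) _ => [z []//|].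
by apply: sub_smooth_on sP => z [].
Qed.

(** Counterpart of [smooth_on_subst_phase]: the definition of [smooth_jet], applied to the family of
    curves with [s] adjoined to the parameters, takes the place of the chain rule. *)
Lemma smooth_on_subst_jet (V : normedModType R) (O : set V)
    (F : nat -> jet R n -> R) (a : nat -> V -> jet R n) m :
  open O -> (forall i, smooth_jet (F i)) ->
  (forall j k, smooth_on O (fun y => a j y k)) -> (forall y, O y -> U (a 0%N y 0%N)) ->
  smooth_on O (fun y => subst_series F (a^~ y) m).
Proof.
move=> oO sF sa Ua.
pose P (z : (V * R)%type) := \sum_(j < m.+1) z.2 ^+ j *: a j z.1.
have P0 y : P (y, 0) = a 0%N y := sum_expr0 m (a^~ y).
have oO' := @open_fst R V R _ oO.
have sP k : smooth_on [set z : (V * R)%type | O z.1] (fun z => P z k).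
  have -> : (fun z => P z k) = (fun z => \sum_(j < m.+1) z.2 ^+ j *: a j z.1 k).
    by apply/funext => z; exact: (sum_jetE _ _ (a^~ z.1)).
  by apply: (@smooth_on_power_sum _ _ _ _ (fun j y => a j y k)) => //; exact: framed_cV.
pose A := [set z : (V * R)%type | O z.1] `&` (fun z => P z 0%N) @^-1` U.
have oA : open A by exact: open_smooth_preimage.
apply: (smooth_on_taylor_coef (A := A)
  (f := fun z => \sum_(i < m.+1) z.2 ^+ i * F i (P z))) => //.
  by move=> y Oy; split=> //=; rewrite P0; exact: Ua.
apply: (smooth_on_sum _ oA) => i _; apply: (smooth_on_mul oA).
  apply: (smooth_on_exp _ oA); exact: bounded_linear_smooth (bounded_linear_snd _ _).
apply: sF => // [k|z []//].
by apply: sub_smooth_on (sP k) => z [].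
Qed.

Lemma midpoint_args0 (x : jet R n) : midpoint_args x 0 = (x 0%N, x 1%N).
Proof. by rewrite /midpoint_args/= muln0 expr0 mul1r !invr1 !scale1r. Qed.

Lemma smooth_on_scalec (V W : normedModType R) (A : set V) (f : V -> W) (c : R) :
  framed W -> open A -> smooth_on A f -> smooth_on A (fun x => c *: f x).
Proof. by move=> fr oA; apply: smooth_on_scale => //; exact: smooth_on_cst. Qed.

Lemma smooth_jet_midpoint_series (Lam : nat -> phase R n -> R) m :
  (forall i, smooth_on (U `*` setT) (Lam i)) -> smooth_jet (midpoint_series Lam m).
Proof.
move=> sL V O p oO sp Up.
apply: (smooth_on_subst_phase (a := fun j y => midpoint_args (p y) j)) => //.
  by move=> j; apply: smooth_on_pair => //; apply: smooth_on_scalec => //;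
    exact: framed_cV.
by move=> y Oy; rewrite midpoint_args0; exact: Up.
Qed.

Lemma smooth_jet_lagrangian_jet (Lam : nat -> phase R n -> R) m :
  (forall i, smooth_on (U `*` setT) (Lam i)) -> smooth_jet (lagrangian_jet Lam m).
Proof.
move=> sL V O p oO sp Up; apply: (smooth_on_sum _ oO) => i _.
apply: (smooth_on_mul oO); first exact: smooth_on_cst.
by apply: smooth_jet_iter_total_derivative => //; exact: smooth_jet_midpoint_series.
Qed.

End Jets.

(** * Smoothness of the acceleration, of the on-shell jets and of the elimination *)

Section OnShell.
Context {R : realType} {n : nat} (U : set 'cV[R]_n) (hU : open U).
Let D : set (phase R n) := U `*` setT.
Let oD : open D. Proof. exact: open_phase. Qed.

Lemma inv_series0 (H : nat -> 'M[R]_n) : inv_series H 0 = invmx (H 0%N).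
Proof. by []. Qed.

Lemma inv_seriesS (H : nat -> 'M[R]_n) m :
  inv_series H m.+1 =
  - (invmx (H 0%N) *m \sum_(i < m.+1) H i.+1 *m inv_series H (m - i)).
Proof.
rewrite [LHS]/inv_series /strong_rec size_strong_rec_seq /=.
congr (- (_ *m _)); apply: eq_bigr => i _; congr (_ *m _).
rewrite -[X in X`_ _]/(strong_rec_seq _ m.+1) nth_strong_rec_seq//.
by rewrite subSS ltnS leq_subr.
Qed.

Lemma smooth_on_inv_series (V : normedModType R) (A : set V) (H : V -> nat -> 'M[R]_n) m :
  open A -> (forall x, A x -> H x 0%N \in unitmx) ->
  (forall i, smooth_on A (fun x => H x i)) ->
  smooth_on A (fun x => inv_series (H x) m).
Proof.
move=> oA Hu sH; elim/ltn_ind: m => m IH.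
have sI : smooth_on A (fun x => invmx (H x 0%N)) by exact: smooth_on_invmx.
case: m IH => [//|m] IH.
under eq_fun do rewrite inv_seriesS.
apply: (smooth_on_opp oA); apply: (smooth_on_mulmx oA sI).
apply: (smooth_on_sum _ oA) => i _; apply: (smooth_on_mulmx oA) => //.
by apply: IH; rewrite ltnS leq_subr.
Qed.

Variable Lm : nat -> phase R n -> R.
Hypothesis sLm : forall i, smooth_on D (Lm i).
Hypothesis uLm : forall x, D x -> hessian_v (Lm 0%N) x \in unitmx.

Lemma smooth_on_acceleration m : smooth_on D (acceleration Lm m).
Proof.
apply: (smooth_on_sum _ oD) => i _; apply: (smooth_on_mulmx oD).
  apply: (smooth_on_inv_series (H := fun x k => hessian_v (Lm k) x)) => // k.
  apply: (smooth_on_mx oD) => j j'; rewrite /hessian_v.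
  by under eq_fun do rewrite mxE; do 2 apply: smooth_on_derive.
apply: (smooth_on_add oD).
  apply: (smooth_on_mx oD) => j j'; rewrite /gradient_q.
  by under eq_fun do rewrite mxE; apply: smooth_on_derive.
apply: (smooth_on_opp oD); apply: (smooth_on_mulmx oD); last first.
  exact: bounded_linear_smooth (bounded_linear_snd _ _).
apply: (smooth_on_mx oD) => j j'; rewrite /mixed_qv.
by under eq_fun do rewrite mxE; do 2 apply: smooth_on_derive.
Qed.

(** The direction varies with the point, so it is expanded in a frame: the result is a combination
    of derivatives in fixed directions whose coefficients are smooth. *)
Lemma smooth_on_derive_field (W : normedModType R) (f : phase R n -> W)
    (v : phase R n -> phase R n) :
  framed W -> smooth_on D f -> smooth_on D v -> smooth_on D (fun x => 'D_(v x) f x).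
Proof.
move=> frW sf sv; have [I [e [c [bc fr]]]] := @framed_phase R n.
apply: (@eq_smooth_on _ _ _ _ (fun x => \sum_i c i (v x) *: 'D_(e i) f x)) => //.
  move=> x Dx; have df := smooth_on_differentiable sf Dx.
  rewrite [RHS]deriveE// [in RHS](fr (v x)) linear_sum/=.
  by apply: eq_bigr => i _; rewrite linearZ/= -deriveE.
apply: (smooth_on_sum _ oD) => i _; apply: (smooth_on_scale frW oD).
  exact: (smooth_on_postlinear oD (bc i)).
exact: smooth_on_derive.
Qed.

Lemma smooth_on_derivative_along (A : nat -> phase R n -> 'cV[R]_n) m :
  (forall i, smooth_on D (A i)) -> smooth_on D (derivative_along Lm A m).
Proof.
move=> sA; have frn := @framed_cV R n.
apply: (smooth_on_add oD).
  apply: (smooth_on_derive_field frn (sA m)); apply: (smooth_on_pair oD).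
    exact: bounded_linear_smooth (bounded_linear_snd _ _).
  exact: smooth_on_cst.
apply: (smooth_on_sum _ oD) => i _; apply: (smooth_on_derive_field frn (sA i)).
apply: (smooth_on_pair oD); first exact: smooth_on_cst.
exact: smooth_on_acceleration.
Qed.

Lemma smooth_on_on_shell k m : smooth_on D (on_shell Lm k m).
Proof.
elim: k m => [|[|[|k]] IH] m.
- case: m => [|m] /=; last exact: smooth_on_cst.
  exact: bounded_linear_smooth (bounded_linear_fst _ _).
- case: m => [|m] /=; last exact: smooth_on_cst.
  exact: bounded_linear_smooth (bounded_linear_snd _ _).
- exact: smooth_on_acceleration.
- exact: smooth_on_derivative_along.
Qed.

Lemma smooth_on_eliminate (F : nat -> jet R n -> R) m :
  (forall i, smooth_jet U (F i)) -> smooth_on D (eliminate Lm F m).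
Proof.
move=> sF; apply: (smooth_on_subst_jet hU
  (a := fun j x (k : nat) => on_shell Lm k j x)) => //.
  by move=> j k; exact: smooth_on_on_shell.
by move=> y [].
Qed.

End OnShell.

(** * Taylor coefficients *)

Section TaylorCoefficients.
Context {R : realType}.
Implicit Types (A : set R) (f g : R -> R).

Lemma eq_derive1n A f g m s :
  open A -> (forall s, A s -> f s = g s) -> A s -> derive1n m f s = derive1n m g s.
Proof.
move=> oA fg; elim: m s => [|m IH] s As; first exact: fg.
by rewrite !derive1nS !derive1E; exact: (open_derive_eq _ oA IH As).
Qed.

Lemma smooth_on_derive1n A f m :
  open A -> smooth_on A f -> smooth_on A (derive1n m f).
Proof.
move=> oA sf; elim: m => // m IH; rewrite derive1nS.
apply: (@eq_smooth_on _ _ _ _ ('D_1 (derive1n m f))) => //; last exact: smooth_on_derive.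
by move=> x _; rewrite derive1E.
Qed.

Lemma derive1nD A f g m s :
  open A -> A s -> smooth_on A f -> smooth_on A g ->
  derive1n m (fun s => f s + g s) s = derive1n m f s + derive1n m g s.
Proof.
move=> oA As sf sg; elim: m s As => // m IH s As.
rewrite !derive1nS !derive1E -deriveD; first exact: (open_derive_eq _ oA IH As).
  exact: (smooth_on_derivable (smooth_on_derive1n m oA sf) As).
exact: (smooth_on_derivable (smooth_on_derive1n m oA sg) As).
Qed.

Lemma derive1n_cst m (c s : R) : derive1n m.+1 (cst c) s = 0.
Proof.
elim: m s => [|m IH] s; first by rewrite derive1n1 derive1E derive_cst.
rewrite derive1nS; have -> : derive1n m.+1 (cst c) = cst 0 by apply/funext.
by rewrite derive1E derive_cst.
Qed.

Lemma taylor_coef_cst m (c : R) : taylor_coef m (cst c) = if m == 0%N then c else 0.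
Proof.
case: m => [|m]; first by rewrite /taylor_coef/= divr1.
by rewrite /taylor_coef derive1n_cst mul0r.
Qed.

Lemma eq_taylor_coef A f g m :
  open A -> A 0 -> (forall s, A s -> f s = g s) -> taylor_coef m f = taylor_coef m g.
Proof. by move=> oA A0 fg; rewrite /taylor_coef (eq_derive1n _ oA fg). Qed.

Lemma taylor_coef0 f : taylor_coef 0 f = f 0.
Proof. by rewrite /taylor_coef/= divr1. Qed.

Lemma taylor_coefD A f g m :
  open A -> A 0 -> smooth_on A f -> smooth_on A g ->
  taylor_coef m (fun s => f s + g s) = taylor_coef m f + taylor_coef m g.
Proof. by move=> oA A0 sf sg; rewrite /taylor_coef (derive1nD _ oA)// mulrDl. Qed.

Lemma taylor_coef_sum A (I : Type) (r : seq I) (f : I -> R -> R) m :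
  open A -> A 0 -> (forall i, smooth_on A (f i)) ->
  taylor_coef m (fun s => \sum_(i <- r) f i s) = \sum_(i <- r) taylor_coef m (f i).
Proof.
move=> oA A0 sf; elim: r => [|i r IH].
  rewrite big_nil; under eq_fun do rewrite big_nil.
  by rewrite (taylor_coef_cst m 0) if_same.
rewrite big_cons; under eq_fun do rewrite big_cons.
rewrite (taylor_coefD m oA A0 (sf i)) ?IH//.
by apply: (smooth_on_sum _ oA) => j _.
Qed.

Lemma smooth_on_id A : open A -> smooth_on A (@id R).
Proof. by move=> oA; exact: bounded_linear_smooth (bounded_linear_id _). Qed.

(** The Leibniz rule for the factor [s], all of whose derivatives beyond the first vanish. At
    [s = 0] only the last term remains, and its factor [m.+1] turns the factorial of [m.+1] into
    that of [m]. *)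
Lemma derive1n_mulid A g m s :
  open A -> A s -> smooth_on A g ->
  derive1n m.+1 (fun s => s * g s) s =
  s * derive1n m.+1 g s + m.+1%:R * derive1n m g s.
Proof.
move=> oA + sg.
have dg k t : A t -> derivable (derive1n k g) t 1.
  by move=> At; exact: (smooth_on_derivable (smooth_on_derive1n k oA sg)).
have key (h : R -> R) (t : R) : derivable h t 1 ->
    'D_1 (fun s : R => s * h s) t = t * 'D_1 h t + h t.
  move=> dh; rewrite (@deriveM _ _ id h)//.
  by rewrite derive_id [_ *: 1]mulr1.
elim: m s => [|m IH] s As.
  by rewrite !derive1n1 !derive1E derive1n0 key ?mul1r//; exact: (dg 0%N).
rewrite derive1nS derive1E (open_derive_eq _ oA IH As) deriveD; last first.
- by apply: derivableM => //; exact: dg.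
- by apply: derivableM => //; exact: dg.
rewrite key; last exact: dg.
rewrite deriveMl; last exact: dg.
rewrite -!derive1E -!derive1nS -addrA; congr (_ + _).
by rewrite -[X in X + _]mul1r -mulrDl [1 + _]addrC natr1.
Qed.

Lemma taylor_coefS_mulid A g m :
  open A -> A 0 -> smooth_on A g ->
  taylor_coef m.+1 (fun s => s * g s) = taylor_coef m g.
Proof.
move=> oA A0 sg; rewrite /taylor_coef (derive1n_mulid _ oA)// mul0r add0r.
by rewrite factS natrM invfM mulrACA mulfV ?mul1r// pnatr_eq0.
Qed.

Lemma taylor_coef_mulX A g i m :
  open A -> A 0 -> smooth_on A g ->
  taylor_coef m (fun s => s ^+ i * g s) = if (i <= m)%N then taylor_coef (m - i) g else 0.
Proof.
move=> oA A0; elim: i m g => [|i IH] m g sg.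
  by rewrite subn0; under eq_fun do rewrite expr0 mul1r.
have -> : (fun s => s ^+ i.+1 * g s) = (fun s => s * (s ^+ i * g s)).
  by apply/funext => s; rewrite exprS mulrA.
case: m => [|m]; first by rewrite taylor_coef0 mul0r.
rewrite (taylor_coefS_mulid m oA)// ?IH//.
apply: (smooth_on_mul oA) => //; apply: (smooth_on_exp _ oA); exact: smooth_on_id.
Qed.

Lemma taylor_coef_series A (f : nat -> R -> R) m :
  open A -> A 0 -> (forall i, smooth_on A (f i)) ->
  taylor_coef m (fun s => \sum_(i < m.+1) s ^+ i * f i s) =
  \sum_(i < m.+1) taylor_coef (m - i) (f i).
Proof.
move=> oA A0 sf.
rewrite (taylor_coef_sum (f := fun (i : 'I_m.+1) s => s ^+ i * f i s) _ _ oA)//.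
  apply: eq_bigr => i _; rewrite (taylor_coef_mulX _ _ oA)//.
  by rewrite -ltnS ltn_ord.
move=> i; apply: (smooth_on_mul oA) => //; apply: (smooth_on_exp _ oA); exact: smooth_on_id.
Qed.


End TaylorCoefficients.

(** * Perturbations of order [s ^+ m] leave the derivatives of order below [m] at 0 unchanged *)

Section Perturbation.
Context {R : realType}.
Lemma derive_along_power (A : set (R * R)%type) (Psi : (R * R)%type -> R) m s :
  smooth_on A Psi -> A (s, s ^+ m.+1) ->
  'D_1 (fun s : R => Psi (s, s ^+ m.+1)) s =
  'D_((1, 0) : R * R) Psi (s, s ^+ m.+1) +
  s ^+ m * (m.+1%:R * 'D_((0, 1) : R * R) Psi (s, s ^+ m.+1)).
Proof.
move=> sP As; have dP := smooth_on_differentiable sP As.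
have dX : differentiable (fun s : R => s ^+ m.+1) s.
  have oRT : open (setT : set R) by exact: openT.
  exact: (smooth_on_differentiable (smooth_on_exp m.+1 oRT (smooth_on_id oRT)) I).
have dc : differentiable (fun s : R => (s, s ^+ m.+1)) s.
  by apply: differentiable_pair.
rewrite -[fun s : R => Psi _]/(Psi \o (fun s : R => (s, s ^+ m.+1))).
rewrite deriveE; last exact: differentiable_comp.
rewrite (diff_comp dc dP)/= diff_pair//=.
rewrite -(deriveE _ dX) (_ : 'd (fun x : R => x) s 1 = 1); last first.
  by rewrite -deriveE// derive_id.
have -> : 'D_1 (fun s : R => s ^+ m.+1) s = s ^+ m * m.+1%:R.
  have := @exp_derive1 R m.+1 s; rewrite derive1E => ->.
  by rewrite [_ *: _]mulr_natl [RHS]mulr_natr.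
set c := _ * m.+1%:R.
have -> : ((1, c) : R * R) = (1, 0) + c *: (0, 1).
  by rewrite -[RHS]/(1 + c * 0, 0 + c * 1) mulr0 addr0 add0r mulr1.
by rewrite linearD linearZ/= -!deriveE// /c mulrA.
Qed.

(** Induction on [j] in place of a formula for higher derivatives of a composite. One derivative
    along [(s, s ^+ m.+1)] gives a function of the same shape, with [Psi] replaced by its first
    partial derivative, plus [s ^+ m] times a smooth function, which does not contribute to order
    [j < m]. *)
Lemma derive1n_perturb (A : set (R * R)%type) (Psi : (R * R)%type -> R) m j :
  open A -> A (0, 0) -> smooth_on A Psi -> (j < m)%N ->
  derive1n j (fun s : R => Psi (s, s ^+ m)) 0 = derive1n j (fun s : R => Psi (s, 0)) 0.
Proof.
move=> oA A00; elim: j m Psi => [|j IH] [//|m] Psi sP; first by rewrite /= expr0n.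
rewrite ltnS => jm.
have oRT : open (setT : set R) by exact: openT.
have scX k : smooth_on (setT : set R) (fun s : R => (s, s ^+ k)).
  by apply: (smooth_on_pair oRT); [|apply: (smooth_on_exp _ oRT)]; exact: smooth_on_id.
have sc0 : smooth_on (setT : set R) (fun s : R => (s, 0 : R)).
  by apply: (smooth_on_pair oRT); [exact: smooth_on_id|exact: smooth_on_cst].
pose B := [set: R] `&` (fun s : R => (s, s ^+ m.+1)) @^-1` A.
pose B0 := [set: R] `&` (fun s : R => (s, 0)) @^-1` A.
have oB : open B by exact: open_smooth_preimage.
have oB0 : open B0 by exact: open_smooth_preimage.
have B0' : B 0 by split=> //=; rewrite expr0n.
have B00 : B0 0 by [].
have sD v : smooth_on A ('D_v Psi) by exact: smooth_on_derive.
have sDB v : smooth_on B (fun s : R => 'D_v Psi (s, s ^+ m.+1)).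
  apply: (smooth_on_comp (framed_pair framed_scalar framed_scalar) oB oA) (sD v) _.
    by move=> x [].
  by apply: sub_smooth_on (scX m.+1).
(* The first derivative is taken innermost, so that the induction hypothesis, general in [Psi],
   meets a partial derivative of [Psi]. *)
rewrite !derive1Sn.
rewrite (@eq_derive1n R B _ (fun s : R => 'D_((1, 0) : R * R) Psi (s, s ^+ m.+1) +
  s ^+ m * (m.+1%:R * 'D_((0, 1) : R * R) Psi (s, s ^+ m.+1))))//; last first.
  by move=> s [_ As]; rewrite derive1E; exact: (derive_along_power sP).
rewrite [RHS](@eq_derive1n R B0 _ (fun s : R => 'D_((1, 0) : R * R) Psi (s, 0)))//; last first.
  move=> s [_ As]; rewrite derive1E.
  have bl := bounded_linear_inl R R.
  have [dl El] := bounded_linear_diff s bl.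
  have dP : differentiable Psi ((fun v : R => (v, 0) : R * R) s).
    exact: smooth_on_differentiable sP As.
  rewrite -[fun s : R => Psi _]/(Psi \o (fun v : R => (v, 0) : R * R)).
  rewrite deriveE; last exact: differentiable_comp.
  by rewrite (diff_comp dl dP)/= El -deriveE.
have sg : smooth_on B (fun s : R => m.+1%:R * 'D_((0, 1) : R * R) Psi (s, s ^+ m.+1)).
  by apply: (smooth_on_mul oB); first exact: smooth_on_cst.
rewrite (derive1nD _ oB)//; last first.
  apply: (smooth_on_mul oB) => //; apply: (smooth_on_exp _ oB); exact: smooth_on_id.
rewrite (IH m.+1 ('D_((1, 0) : R * R) Psi) (sD _) (leq_trans jm (leqnSn m))).
rewrite -[RHS]addr0; congr (_ + _).
have := taylor_coef_mulX m j oB B0' sg; rewrite leqNgt jm /= /taylor_coef.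
by move/eqP; rewrite mulf_eq0 invr_eq0 pnatr_eq0 (gtn_eqF (fact_gt0 j)) orbF => /eqP.
Qed.

End Perturbation.

(** * Triangularity of the elimination *)

Section Locality.
Context {R : realType} {n : nat} (U : set 'cV[R]_n) (hU : open U).
Let D : set (phase R n) := U `*` setT.
Let oD : open D. Proof. exact: open_phase. Qed.

Lemma smooth_on_curve (W : normedModType R) m (a : nat -> W) :
  framed W -> smooth_on (setT : set R) (fun s => \sum_(j < m) s ^+ j *: a j).
Proof.
move=> fr; have oT : open (setT : set R) := openT.
apply: (smooth_on_sum _ oT) => j _; apply: (smooth_on_scale fr oT).
  exact: (smooth_on_exp _ oT (smooth_on_id oT)).
exact: smooth_on_cst.
Qed.

(** A polynomial curve of jets that starts over [U] need stay over [U] only near [s = 0]; this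
    yields an open neighbourhood on which its Taylor coefficients can be computed. *)
Lemma smooth_jet_curve (a : nat -> jet R n) m (F : jet R n -> R) :
  U (a 0%N 0%N) -> smooth_jet U F ->
  exists2 A : set R, open A /\ A 0 &
    smooth_on A (fun s => F (\sum_(j < m.+1) s ^+ j *: a j)) /\
    forall s, A s -> U ((\sum_(j < m.+1) s ^+ j *: a j) 0%N).
Proof.
move=> Ua sF; pose P (s : R) := \sum_(j < m.+1) s ^+ j *: a j.
have oT : open (setT : set R) := openT.
have sP k : smooth_on (setT : set R) (fun s => P s k).
  have -> : (fun s => P s k) = (fun s => \sum_(j < m.+1) s ^+ j *: a j k).
    by apply/funext => s; exact: sum_jetE.
  exact: (@smooth_on_curve _ _ (a^~ k) (framed_cV n)).
pose A := [set: R] `&` (fun s => P s 0%N) @^-1` U.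
have oA : open A by exact: open_smooth_preimage.
exists A; first by split=> //; split=> //=; rewrite /P sum_expr0.
split=> [|s []//].
apply: sF => // [k|s []//].
by apply: sub_smooth_on (sP k) => z [].
Qed.

(** The coefficient in front of [w] is made an independent variable [t], which gives a smooth
    function of [(s, t)]; the two sides are its restrictions to [t = s ^+ m] and to [t = 0]. *)
Lemma taylor_coef_perturb (a : nat -> jet R n) (w : jet R n) m k (F : jet R n -> R) :
  U (a 0%N 0%N) -> smooth_jet U F -> (k < m)%N ->
  taylor_coef k (fun s => F (\sum_(j < m) s ^+ j *: a j + s ^+ m *: w)) =
  taylor_coef k (fun s => F (\sum_(j < m) s ^+ j *: a j)).
Proof.
case: m => [//|m] Ua sF km.
pose P (z : R * R) : jet R n := fun i => (\sum_(j < m.+1) z.1 ^+ j *: a j) i + z.2 *: w i.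
have oT : open (setT : set R) := openT.
have oT2 : open (setT : set (R * R)) := openT.
have sP i : smooth_on (setT : set (R * R)) (fun z => P z i).
  apply: (smooth_on_add oT2).
    have -> : (fun z : R * R => (\sum_(j < m.+1) z.1 ^+ j *: a j) i) =
              (fun z => \sum_(j < m.+1) z.1 ^+ j *: a j i).
      by apply/funext => z; exact: sum_jetE.
    apply: (smooth_on_param (f := fun s : R => \sum_(j < m.+1) s ^+ j *: a j i) oT).
    exact: (@smooth_on_curve _ _ (a^~ i) (framed_cV n)).
  apply: (smooth_on_scale (framed_cV n) oT2).
    exact: bounded_linear_smooth (bounded_linear_snd _ _).
  exact: smooth_on_cst.
pose A := [set: R * R] `&` (fun z => P z 0%N) @^-1` U.
have oA : open A by exact: open_smooth_preimage.
have A00 : A (0, 0).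
  by split=> //=; rewrite /P/= scale0r addr0 sum_expr0.
have sFP : smooth_on A (fun z => F (P z)).
  apply: sF => // [i|s []//].
  by apply: sub_smooth_on (sP i) => z [].
have := derive1n_perturb oA A00 sFP km.
rewrite /taylor_coef => e; congr (_ / _).
have -> : (fun s => F (\sum_(j < m.+1) s ^+ j *: a j)) = (fun s => F (P (s, 0))).
  apply/funext => s; congr (F _); apply/funext => i.
  by rewrite /P/= scale0r addr0.
exact: e.
Qed.

Lemma subst_series_jet (F : nat -> jet R n -> R) (a : nat -> jet R n) m :
  (forall i, smooth_jet U (F i)) -> U (a 0%N 0%N) ->
  subst_series F a m = \sum_(i < m.+1)
    taylor_coef (m - i) (fun s => F i (\sum_(j < m.+1) s ^+ j *: a j)).
Proof.
move=> sF Ua.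
have [A [oA A0] [_ UA]] := smooth_jet_curve m Ua (sF 0%N).
rewrite /subst_series.
apply: (taylor_coef_series (A := A)
  (f := fun i s => F i (\sum_(j < m.+1) s ^+ j *: a j))) => // i.
pose P (s : R) := \sum_(j < m.+1) s ^+ j *: a j.
apply: (sF i R A P) => // k.
have -> : (fun s => P s k) = (fun s => \sum_(j < m.+1) s ^+ j *: a j k).
  by apply/funext => s; exact: sum_jetE.
apply: (sub_smooth_on (B := setT)) => //.
exact: (@smooth_on_curve _ _ (a^~ k) (framed_cV n)).
Qed.

Lemma eq_taylor_coef_jet (F G : jet R n -> R) (a : nat -> jet R n) m k :
  U (a 0%N 0%N) -> (forall x, U (x 0%N) -> F x = G x) ->
  taylor_coef k (fun s => F (\sum_(j < m.+1) s ^+ j *: a j)) =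
  taylor_coef k (fun s => G (\sum_(j < m.+1) s ^+ j *: a j)).
Proof.
move=> Ua FG.
(* The zero function is a dummy: [smooth_jet_curve] is used only for the neighbourhood on which the
   curve stays over [U]. *)
have s0 : smooth_jet U (fun=> 0) by move=> V O p *; exact: smooth_on_cst.
have [A [oA A0] [_ UA]] := smooth_jet_curve m Ua s0.
by apply: (eq_taylor_coef (A := A)) => // s As; apply: FG; exact: UA.
Qed.

Lemma subst_series_phase (F : nat -> phase R n -> R) (a : nat -> phase R n) m :
  (forall i, smooth_on D (F i)) -> U (a 0%N).1 ->
  subst_series F a m = \sum_(i < m.+1)
    taylor_coef (m - i) (fun s => F i (\sum_(j < m.+1) s ^+ j *: a j)).
Proof.
move=> sF Ua.
have oT : open (setT : set R) := openT.
have sP : smooth_on (setT : set R) (fun s => \sum_(j < m.+1) s ^+ j *: a j).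
  exact: (@smooth_on_curve _ _ a (framed_phase n)).
pose A := [set: R] `&` (fun s => \sum_(j < m.+1) s ^+ j *: a j) @^-1` D.
have oA : open A by exact: open_smooth_preimage.
apply: (taylor_coef_series (A := A)
  (f := fun i s => F i (\sum_(j < m.+1) s ^+ j *: a j))) => // [|i].
  by split=> //; rewrite /preimage/= (sum_expr0 m a).
apply: (smooth_on_comp (framed_phase n) oA oD) (sF i) _ => [y []//|].
by apply: sub_smooth_on sP => z [].
Qed.

Lemma eq_taylor_coef_phase (F G : phase R n -> R) (a : nat -> phase R n) m k :
  U (a 0%N).1 -> (forall x, D x -> F x = G x) ->
  taylor_coef k (fun s => F (\sum_(j < m.+1) s ^+ j *: a j)) =
  taylor_coef k (fun s => G (\sum_(j < m.+1) s ^+ j *: a j)).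
Proof.
move=> Ua FG.
have oT : open (setT : set R) := openT.
have sP : smooth_on (setT : set R) (fun s => \sum_(j < m.+1) s ^+ j *: a j).
  exact: (@smooth_on_curve _ _ a (framed_phase n)).
pose A := [set: R] `&` (fun s => \sum_(j < m.+1) s ^+ j *: a j) @^-1` D.
have oA : open A by exact: open_smooth_preimage.
apply: (eq_taylor_coef (A := A)) => // [|s [_ Ds]]; last exact: FG.
by split=> //; rewrite /preimage/= (sum_expr0 m a).
Qed.

(** The summand of index [m] is a coefficient of order 0, that is, the value of [Lam m] at the
    starting point [(q, qdot)] of the midpoint arguments. All other summands involve [Lam i] with
    [i < m]. *)
Lemma midpoint_series_top (Lam Lam' : nat -> phase R n -> R) m (x : jet R n) :
  (forall i, smooth_on D (Lam i)) -> (forall i, smooth_on D (Lam' i)) ->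
  (forall i y, (i < m)%N -> D y -> Lam i y = Lam' i y) -> U (x 0%N) ->
  midpoint_series Lam m x - Lam m (x 0%N, x 1%N) =
  midpoint_series Lam' m x - Lam' m (x 0%N, x 1%N).
Proof.
move=> sL sL' LL Ux.
have Ua : U (midpoint_args x 0).1 by rewrite midpoint_args0.
have e (G : nat -> phase R n -> R) : (forall i, smooth_on D (G i)) ->
    midpoint_series G m x - G m (x 0%N, x 1%N) = \sum_(i < m) taylor_coef (m - i)
      (fun s => G i (\sum_(j < m.+1) s ^+ j *: midpoint_args x j)).
  move=> sG; rewrite /midpoint_series subst_series_phase//.
  rewrite big_ord_recr/= subnn taylor_coef0 (sum_expr0 m (midpoint_args x)).
  by rewrite midpoint_args0 addrK.
rewrite !e//; apply: eq_bigr => i _.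
by apply: eq_taylor_coef_phase => // y Dy; exact: LL.
Qed.

Lemma eq_midpoint_series (Lam Lam' : nat -> phase R n -> R) m (x : jet R n) :
  (forall i, smooth_on D (Lam i)) -> (forall i, smooth_on D (Lam' i)) ->
  (forall i y, (i <= m)%N -> D y -> Lam i y = Lam' i y) -> U (x 0%N) ->
  midpoint_series Lam m x = midpoint_series Lam' m x.
Proof.
move=> sL sL' LL Ux; apply: (addIr (- Lam m (x 0%N, x 1%N))).
rewrite (midpoint_series_top sL sL')//; last by move=> i y /ltnW; exact: LL.
by rewrite LL.
Qed.

Lemma eq_total_derivative (F G : jet R n -> R) :
  (forall x, U (x 0%N) -> F x = G x) ->
  forall x, U (x 0%N) -> total_derivative F x = total_derivative G x.
Proof.
move=> FG x Ux; rewrite /total_derivative !derive1E; apply: near_eq_derive.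
have oT : open (setT : set R) := openT.
(* The total derivative moves the base point along [q + t qdot], which stays in [U] for small
   [t]. *)
pose A := [set: R] `&` (fun t : R => x 0%N + t *: x 1%N) @^-1` U.
have oA : open A.
  apply: open_smooth_preimage => //; apply: (smooth_on_add oT).
    exact: smooth_on_cst.
  exact: bounded_linear_smooth (bounded_linear_scalel _).
apply: (open_near oA) => [|t [_ At]]; last exact: FG.
by split=> //=; rewrite scale0r addr0.
Qed.

Lemma eq_iter_total_derivative k (F G : jet R n -> R) :
  (forall x, U (x 0%N) -> F x = G x) ->
  forall x, U (x 0%N) ->
  iter k (@total_derivative R n) F x = iter k (@total_derivative R n) G x.
Proof. by move=> FG; elim: k => //= k; exact: eq_total_derivative. Qed.

Lemma bernoulli0 : bernoulli R 0 = 1.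
Proof. by have := bernoulliP R 0; rewrite big_ord1 bin0 mul1r. Qed.

Lemma lagrangian_jet_top (Lam Lam' : nat -> phase R n -> R) m (x : jet R n) :
  (forall i, smooth_on D (Lam i)) -> (forall i, smooth_on D (Lam' i)) ->
  (forall i y, (i < m)%N -> D y -> Lam i y = Lam' i y) -> U (x 0%N) ->
  lagrangian_jet Lam m x - Lam m (x 0%N, x 1%N) =
  lagrangian_jet Lam' m x - Lam' m (x 0%N, x 1%N).
Proof.
move=> sL sL' LL Ux; rewrite /lagrangian_jet !big_ord_recl.
have -> : nat_of_ord (@ord0 m) = 0%N by [].
(* The weight of the summand [i = 0] is [(2 / 1 - 1) * B_0 / 0! = 1], so [Lam m] enters with
   coefficient 1; the summands with positive [i] use midpoint series of order [m - i < m]. *)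
rewrite muln0 expr0 divr1 bernoulli0 divr1 mulr1 subn0.
rewrite mulr2n addrK !mul1r [iter 0 _ _]/= [X in _ = X + _ - _]/= addrAC [RHS]addrAC (midpoint_series_top sL sL')//.
congr (_ + _); apply: eq_bigr => i _; congr (_ * _).
apply: eq_iter_total_derivative => // y Uy.
apply: eq_midpoint_series => // j z jm; apply: LL.
by apply: (leq_ltn_trans jm); rewrite lift0 ltn_subrL (leq_ltn_trans _ (ltn_ord i)).
Qed.

Lemma eq_lagrangian_jet (Lam Lam' : nat -> phase R n -> R) m (x : jet R n) :
  (forall i, smooth_on D (Lam i)) -> (forall i, smooth_on D (Lam' i)) ->
  (forall i y, (i <= m)%N -> D y -> Lam i y = Lam' i y) -> U (x 0%N) ->
  lagrangian_jet Lam m x = lagrangian_jet Lam' m x.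
Proof.
move=> sL sL' LL Ux; apply: (addIr (- Lam m (x 0%N, x 1%N))).
rewrite (lagrangian_jet_top sL sL')//; last by move=> i y /ltnW; exact: LL.
by rewrite LL.
Qed.

Lemma lagrangian_jet0 (Lam : nat -> phase R n -> R) (x : jet R n) :
  lagrangian_jet Lam 0 x = Lam 0%N (x 0%N, x 1%N).
Proof.
rewrite /lagrangian_jet big_ord1 muln0 expr0 divr1 bernoulli0 divr1 mulr1/=.
rewrite mulr2n addrK mul1r /midpoint_series /subst_series taylor_coef0.
by rewrite big_ord1 big_ord1 !expr0 mul1r scale1r midpoint_args0.
Qed.

Lemma eq_inv_series (H H' : nat -> 'M[R]_n) m :
  (forall i, (i <= m)%N -> H i = H' i) -> inv_series H m = inv_series H' m.
Proof.
elim/ltn_ind: m => [[|m]] IH HH; first by rewrite !inv_series0 HH.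
rewrite (inv_seriesS H) (inv_seriesS H') (HH 0%N isT).
congr (- (_ *m _)); apply: eq_bigr => i _.
have e : inv_series H (m - i) = inv_series H' (m - i).
  apply: IH => [|j jm]; first by rewrite ltnS leq_subr.
  by apply/HH/(leq_trans jm)/(leq_trans (leq_subr _ _)).
by rewrite e (HH i.+1 (ltn_ord i)).
Qed.

Section OnShellLocality.
Variables (Lm Lm' : nat -> phase R n -> R) (m : nat).
Hypothesis LL : forall i x, (i < m)%N -> D x -> Lm i x = Lm' i x.

(** Order [j] involves derivatives of [Lm k] for [k <= j] only, and agreement on the open set [D]
    passes to derivatives. *)
Lemma eq_acceleration j x :
  (j < m)%N -> D x -> acceleration Lm j x = acceleration Lm' j x.
Proof.
move=> jm Dx.
have d1 v i : (i < m)%N -> forall y, D y -> 'D_v (Lm i) y = 'D_v (Lm' i) y.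
  by move=> im; apply: (open_derive_eq _ oD) => y; exact: LL.
have d2 v w i : (i < m)%N -> 'D_w ('D_v (Lm i)) x = 'D_w ('D_v (Lm' i)) x.
  by move=> im; apply: (open_derive_eq _ oD) => //; exact: d1.
apply: (@eq_bigr _ _ _ 'I_j.+1) => i _.
have im : (j - i < m)%N by exact: leq_ltn_trans (leq_subr _ _) jm.
apply: (f_equal2 (fun (M : 'M[R]_n) (v : 'cV[R]_n) => M *m v)).
  apply: eq_inv_series => k ki; apply/matrixP => p q; rewrite [LHS]mxE [RHS]mxE.
  by apply: (d2 _ _ k); rewrite (leq_ltn_trans ki)// (leq_ltn_trans _ jm)// -ltnS.
apply: (f_equal2 (fun (v : 'cV[R]_n) (M : 'M[R]_n) => v - M *m x.2)).
  by apply/matrixP => p q; rewrite [LHS]mxE [RHS]mxE; exact: (d1 _ (j - i)%N).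
by apply/matrixP => p q; rewrite [LHS]mxE [RHS]mxE; exact: (d2 _ _ (j - i)%N).
Qed.

Lemma eq_derivative_along (A A' : nat -> phase R n -> 'cV[R]_n) j x :
  (forall i y, (i < m)%N -> D y -> A i y = A' i y) ->
  (j < m)%N -> D x -> derivative_along Lm A j x = derivative_along Lm' A' j x.
Proof.
move=> AA jm Dx.
have d1 v i : (i < m)%N -> 'D_v (A i) x = 'D_v (A' i) x.
  by move=> im; apply: (open_derive_eq _ oD) => // y; exact: AA.
apply: (f_equal2 (fun u v : 'cV[R]_n => u + v)); first exact: d1.
apply: (@eq_bigr _ _ _ 'I_j.+1) => i _.
have im : (i < m)%N by exact: leq_trans (ltn_ord i) jm.
have jim : (j - i < m)%N by exact: leq_ltn_trans (leq_subr _ _) jm.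
apply: etrans (d1 _ _ im) _.
exact: (f_equal (fun a => 'D_((0, a) : phase R n) (A' i) x)) (eq_acceleration jim Dx).
Qed.

Lemma eq_on_shell k j x :
  (j < m)%N -> D x -> on_shell Lm k j x = on_shell Lm' k j x.
Proof.
elim: k j x => [//|[//|[|k]] IH] j x jm Dx; first exact: eq_acceleration.
exact: eq_derivative_along.
Qed.

End OnShellLocality.

Lemma eliminate0 (Lm Lam : nat -> phase R n -> R) x :
  eliminate Lm (lagrangian_jet Lam) 0 x = Lam 0%N x.
Proof.
rewrite /eliminate /subst_series taylor_coef0 big_ord1 big_ord1 !expr0 mul1r scale1r.
by rewrite lagrangian_jet0/=; case: x.
Qed.

(** At a positive order, the jet Lagrangian of index 0 contributes nothing and the one of top index
    is evaluated at the zeroth-order on-shell jet, where it equals its [Lam] coefficient plus lower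
    data. Every intermediate index leaves an order for which on-shell coefficients below [m]
    suffice, and these are fixed by [Lm i] with [i < m]. The equation for [Lm m] is therefore
    explicit. *)
Lemma eliminate_top (Lm Lm' Lam Lam' : nat -> phase R n -> R) m x :
  (forall i, smooth_on D (Lam i)) -> (forall i, smooth_on D (Lam' i)) ->
  (forall i y, (i < m)%N -> D y -> Lam i y = Lam' i y) ->
  (forall i y, (i < m)%N -> D y -> Lm i y = Lm' i y) -> D x ->
  eliminate Lm (lagrangian_jet Lam) m x - Lam m x =
  eliminate Lm' (lagrangian_jet Lam') m x - Lam' m x.
Proof.
case: m => [|m] sL sL' LL MM Dx; first by rewrite !eliminate0 !subrr.
have Ux : U x.1 by case: Dx.
have sJ (G : nat -> phase R n -> R) : (forall i, smooth_on D (G i)) ->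
    forall i, smooth_jet U (lagrangian_jet G i).
  by move=> sG i; exact: smooth_jet_lagrangian_jet.
pose a (M : nat -> phase R n -> R) : nat -> jet R n := fun j k => on_shell M k j x.
have e (M G : nat -> phase R n -> R) : (forall i, smooth_on D (G i)) ->
    eliminate M (lagrangian_jet G) m.+1 x = \sum_(i < m) taylor_coef (m - i)
      (fun s => lagrangian_jet G i.+1 (\sum_(j < m.+1) s ^+ j *: a M j)) +
    lagrangian_jet G m.+1 (a M 0%N).
  move=> sG; rewrite /eliminate subst_series_jet; [|exact: sJ|exact: Ux].
  rewrite big_ord_recl big_ord_recr/= subn0 subnn.
  rewrite taylor_coef0 (sum_expr0 m.+1 (a M)).
  (* The jet Lagrangian of index 0 sees only [q] and [qdot], whose on-shell series have no terms
     beyond order 0; it is thus constant in [s]. *)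
  have -> : taylor_coef m.+1
      (fun s => lagrangian_jet G 0 (\sum_(j < m.+2) s ^+ j *: a M j)) = 0.
    have -> : (fun s => lagrangian_jet G 0 (\sum_(j < m.+2) s ^+ j *: a M j)) =
        cst (G 0%N x).
      apply/funext => s; rewrite lagrangian_jet0 !sum_jetE.
      have cE k : (forall j, a M j.+1 k = 0) ->
          \sum_(j < m.+2) s ^+ j *: a M j k = a M 0%N k.
        move=> a0; rewrite big_ord_recl expr0 scale1r big1 ?addr0// => i _.
        by rewrite lift0 a0 scaler0.
      by rewrite !cE// /a/= -surjective_pairing.
    by rewrite taylor_coef_cst.
  rewrite add0r; congr (_ + _); apply: eq_bigr => i _.
  rewrite -[bump 0 i]/(i.+1) subSS.
  (* The cut-off in [subst_series] still includes [s ^+ m.+1] times the on-shell coefficient of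
     index [m.+1], which would involve [M m.+1]. The order needed here is [m - i], at most [m], so
     this term may be dropped. *)
  rewrite -(@taylor_coef_perturb (a M) (a M m.+1) m.+1)//; last 2 first.
  - exact: sJ.
  - by rewrite ltnS leq_subr.
  by congr taylor_coef; apply/funext => s; rewrite [in LHS]big_ord_recr.
have aE j k : (j < m.+1)%N -> a Lm j k = a Lm' j k.
  by move=> jm; exact: (eq_on_shell MM).
rewrite !e// -!addrA; congr (_ + _); last first.
  have -> : a Lm 0%N = a Lm' 0%N by apply/funext => k; exact: aE.
  have := lagrangian_jet_top (x := a Lm' 0%N) sL sL' LL Ux.
  by rewrite /a/= -surjective_pairing.
apply: eq_bigr => i _.
rewrite -(eq_taylor_coef_jet (F := lagrangian_jet Lam i.+1))//; last first.
  move=> y Uy; apply: eq_lagrangian_jet => // j z ji; apply: LL.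
  by rewrite (leq_ltn_trans ji)// ltnS ltn_ord.
congr taylor_coef; apply/funext => s; congr (lagrangian_jet _ _ _).
apply: eq_bigr => j _; congr (_ *: _); apply/funext => k; exact: aE.
Qed.

End Locality.

(** * The surrogate Lagrangian *)

Section Construction.
Context {R : realType} {n : nat} (U : set 'cV[R]_n) (L : phase R n -> R).
Hypothesis hU : open U.
Let D : set (phase R n) := U `*` setT.
Hypothesis hL : smooth_on D L.
Hypothesis hreg : forall x, D x -> hessian_v L x \in unitmx.

(* The m-th term is chosen so as to cancel the remainder of eliminate_top. *)
Definition surrogate_terms : nat -> phase R n -> R :=
  strong_rec (fun u : seq (phase R n -> R) =>
    if size u == 0%N then L
    else fun x => - eliminate (const_series L)
                      (lagrangian_jet (fun i => nth (fun=> 0) u i)) (size u) x).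

Definition truncate_series (S : nat -> phase R n -> R) m : nat -> phase R n -> R :=
  fun i => if (i < m)%N then S i else fun=> 0.

(** A recursion step sees only the list of earlier terms; padding it with zeros makes it a full
    series, with coefficient 0 at the index under construction. *)
Lemma nth_strong_rec_truncate (step : seq (phase R n -> R) -> phase R n -> R) m :
  (fun i => nth (fun=> 0) (strong_rec_seq step m) i) =
  truncate_series (strong_rec step) m.
Proof.
apply/funext => i; rewrite /truncate_series; case: ltnP => im.
  exact: nth_strong_rec_seq.
by rewrite nth_default// size_strong_rec_seq.
Qed.

Lemma surrogate_termsE m : (0 < m)%N ->
  surrogate_terms m = fun x => - eliminate (const_series L)
    (lagrangian_jet (truncate_series surrogate_terms m)) m x.
Proof.
move=> m0; rewrite [LHS]/surrogate_terms [LHS]/strong_rec size_strong_rec_seq.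
by rewrite gtn_eqF// nth_strong_rec_truncate.
Qed.

Lemma smooth_on_const_series i : smooth_on D (const_series L i).
Proof. by rewrite /const_series; case: ifP => // _; exact: smooth_on_cst. Qed.

Lemma smooth_on_truncate S m :
  (forall i, (i < m)%N -> smooth_on D (S i)) ->
  forall i, smooth_on D (truncate_series S m i).
Proof.
move=> sS i; rewrite /truncate_series; case: ifP => [/sS//|_].
exact: smooth_on_cst.
Qed.

Lemma smooth_on_surrogate_terms m : smooth_on D (surrogate_terms m).
Proof.
elim/ltn_ind: m => m IH; have [->//|m0] := posnP m.
rewrite surrogate_termsE//; apply: smooth_on_opp; first exact: open_phase.
apply: smooth_on_eliminate => // [i|i]; first exact: smooth_on_const_series.
by apply: smooth_jet_lagrangian_jet => // j; exact: smooth_on_truncate.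
Qed.

Variable N : nat.
Let S := surrogate L N surrogate_terms.

Lemma smooth_on_surrogate i : smooth_on D (S i).
Proof.
rewrite /S /surrogate; case: ifP => // _; case: ifP => // _.
  exact: smooth_on_surrogate_terms.
exact: smooth_on_cst.
Qed.

(** Through order [N], the constant series [L] satisfies the defining equations of the modified
    Lagrangian. Existence extends this solution beyond [N], and uniqueness compares any other
    solution with it. *)
Lemma eliminate_surrogate m x : (m <= N)%N -> D x ->
  eliminate (const_series L) (lagrangian_jet S) m x = const_series L m x.
Proof.
move=> mN Dx; have [->|m0] := posnP m; first by rewrite eliminate0.
pose T' := truncate_series surrogate_terms m.
have e : S m x = surrogate_terms m x by rewrite /S /surrogate gtn_eqF// mN.
have sT' : forall i, smooth_on D (T' i).
  by apply: smooth_on_truncate => i _; exact: smooth_on_surrogate_terms.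
have ST i y : (i < m)%N -> D y -> S i y = T' i y.
  move=> im _; rewrite /T' /truncate_series im /S /surrogate.
  (* At index 0 both series give [L], since the recursion for [surrogate_terms] starts from [L]. *)
  by rewrite (leq_trans (ltnW im) mN); case: eqP => [->|].
have := eliminate_top hU smooth_on_surrogate sT' ST
  (fun i y (_ : (i < m)%N) _ => erefl (const_series L i y)) Dx.
(* With this zero, [eliminate_top] equates the elimination of [S] minus [surrogate_terms m] with the
   elimination of [T']. As [surrogate_terms m] is minus the latter, the elimination of [S] is 0. *)
have T'0 : T' m x = 0 by rewrite /T' /truncate_series ltnn.
rewrite e (surrogate_termsE m0) T'0 subr0 opprK.
rewrite /const_series gtn_eqF// => H.
by apply: (addIr (eliminate (const_series L) (lagrangian_jet T') m x)); rewrite add0r.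
Qed.

Lemma eliminate_congr (Lm Lm' : nat -> phase R n -> R) m x :
  (forall i y, (i < m)%N -> D y -> Lm i y = Lm' i y) -> D x ->
  eliminate Lm (lagrangian_jet S) m x = eliminate Lm' (lagrangian_jet S) m x.
Proof.
move=> LL Dx; have sS := smooth_on_surrogate.
exact: (addIr _ (eliminate_top hU sS sS (fun _ _ _ _ => erefl) LL Dx)).
Qed.

(** The right-hand side of the [m]-th equation depends only on lower coefficients of [Lm], which by
    induction are those of the constant series. *)
Lemma modified_lagrangian_unique (Lm : nat -> phase R n -> R) m x :
  modified_lagrangian U S Lm -> (m <= N)%N -> D x -> Lm m x = const_series L m x.
Proof.
move=> ml; elim/ltn_ind: m x => m IH x mN Dx.
rewrite (ml m).2// -(eliminate_surrogate mN Dx); apply: eliminate_congr => // i y im Dy.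
by apply: IH => //; exact: leq_trans (ltnW im) mN.
Qed.

Lemma modified_lagrangian_exists :
  exists Lm : nat -> phase R n -> R, modified_lagrangian U S Lm.
Proof.
(* Through order [N] the solution is prescribed to be the constant series; beyond [N] each equation
   is solved for its top coefficient, with the earlier terms padded by zeros. *)
pose step (u : seq (phase R n -> R)) :=
  if (size u <= N)%N then const_series L (size u)
  else eliminate (fun i => nth (fun=> 0) u i) (lagrangian_jet S) (size u).
have [Lm LmD] : {Lm | Lm = strong_rec step} by eexists.
have LmE m : Lm m = if (m <= N)%N then const_series L m
    else eliminate (truncate_series Lm m) (lagrangian_jet S) m.
  rewrite LmD [LHS]/strong_rec [LHS]/step size_strong_rec_seq.
  by rewrite nth_strong_rec_truncate.
have LmC i : (i <= N)%N -> Lm i = const_series L i by rewrite LmE => ->.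
exists Lm => m; split.
  elim/ltn_ind: m => m IH; rewrite LmE.
  case: leqP => [_|Nm]; first exact: smooth_on_const_series.
  have sT := smooth_on_truncate IH.
  (* Here [N < m], so the truncation keeps its coefficient of index 0, which is [L]; regularity of
     [L] then gives smooth on-shell jets. *)
  have uT y : D y -> hessian_v (truncate_series Lm m 0) y \in unitmx.
    by rewrite /truncate_series (leq_ltn_trans _ Nm)// LmC//; exact: hreg.
  have sJ i := smooth_jet_lagrangian_jet hU i smooth_on_surrogate.
  exact: (smooth_on_eliminate hU sT uT m sJ).
move=> x Dx; rewrite {1}LmE; case: leqP => mN.
  rewrite -(eliminate_surrogate mN Dx); apply: eliminate_congr => // i y im _.
  by rewrite LmC//; exact: leq_trans (ltnW im) mN.
by apply: eliminate_congr => // i y im _; rewrite /truncate_series im.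
Qed.

End Construction.

Theorem mainTheorem3 (R : realType) (n : nat) (U : set 'cV[R]_n)
    (L : phase R n -> R) (hU : open U) (hL : smooth_on (U `*` setT) L)
    (hreg : forall x : phase R n, (U `*` setT) x -> hessian_v L x \in unitmx)
    (N : nat) (hN : (1 <= N)%N) :
  exists Ls : nat -> phase R n -> R,
    (forall i : nat, (1 <= i <= N)%N -> smooth_on (U `*` setT) (Ls i)) /\
    (exists Lm : nat -> phase R n -> R,
        modified_lagrangian U (surrogate L N Ls) Lm) /\
    (forall Lm : nat -> phase R n -> R,
        modified_lagrangian U (surrogate L N Ls) Lm ->
        eq_mod_h U (2 * N + 2) Lm (const_series L)).
Proof.
exists (surrogate_terms L); split=> [i _|].
  exact: smooth_on_surrogate_terms.
split=> [|Lm ml k kN x Dx]; first exact: modified_lagrangian_exists.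
(* Odd powers of [h] have coefficient 0 on both sides. For even [k < 2 * N + 2] the index [k./2] is
   at most [N], the range covered by uniqueness. *)
rewrite /coef_h; case: ifP => // ok.
apply: (modified_lagrangian_unique hU hL hreg ml) => //.
by rewrite -ltnS ltn_half_double doubleS -mul2n -addn2.
Qed.
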